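(* Let $Z=\mathbb R^{2N}$ and let $\mu\in\mathcal M(Z\times Z)$. Assume: (i) (Regularity) $\mu = L\,\mathcal L^{2N}\times\mathcal L^{2N}$ with $L\in L^1_{\rm loc}(Z\times Z)$ non-negative. (ii) (Continuity) There exists a function $\hat L:Z\to\mathbb R$ such that $$\hat L\left(\frac{\xi}{\sqrt2}\right)=\lim_{\lambda\to+\infty}L\big(S_\lambda(\xi,\eta)\big)$$ for $\mathcal L^{4N}$-a.e. $(\xi,\eta)\in Z\times Z$. (iii) (Equi-integrability) There are a function $g\in L^1(Z\times Z)$, $\lambda_0>0$ and $\beta_0>0$ such that $$\bar w_{\beta_0}(\eta)\,L\big(S_\lambda(\xi,\eta)\big)\le g(\xi,\eta)$$ for $\mathcal L^{4N}$-a.e. $(\xi,\eta)\in Z\times Z$ and for all $\lambda\ge\lambda_0$. Then the weak limit $\mu_\infty$ of $\mu_\beta$ as $\beta\to+\infty$ exists in $\mathcal M_b(Z\times Z)$ (convergence tested against all $f\in C_b(Z\times Z)$), and $$\mu_\infty(f)=\int_Z f(\xi,\xi)\,\hat L(\xi)\,d\xi\qquad\text{for all } f\in C_b(Z\times Z).$$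
   Context: $N\ge1$ is an integer; $Z=\mathbb R^{2N}$ is endowed with a scalar product, with corresponding norm $\|\cdot\|$. For a metric space $X$, $\mathcal M(X)$ is the set of (positive) Radon measures on $X$ and $\mathcal M_b(X)=\{\mu\in\mathcal M(X):\mu(X)<\infty\}$; $\mu(f):=\int_X f\,d\mu$; $C_b(X)$ is the set of bounded continuous real functions on $X$. Weak convergence $\nu_j\rightharpoonup\nu$ in $\mathcal M_b(X)$ means $\nu_j(f)\to\nu(f)$ for all $f\in C_b(X)$; for $\mu_\beta$ with $\beta\to+\infty$ this is understood with $\mu_\beta\in\mathcal M_b$ for all sufficiently large $\beta$. For $\mu\in\mathcal M(Z\times Z)$ and $\beta>0$, the thermalized measure is $$\mu_\beta:=w_\beta\,\mu,\quad w_\beta(y,z):=B_\beta^{-1}e^{-\beta\|y-z\|^2},\quad B_\beta:=\int_Z e^{-\beta\|\xi\|^2}\,d\xi .$$ For $\lambda>0$, $S_\lambda:Z\times Z\to Z\times Z$ is the linear map $$S_\lambda(\xi,\eta):=\Big(\frac{\xi+\eta/\lambda}{\sqrt2},\frac{\xi-\eta/\lambda}{\sqrt2}\Big),$$ and $\bar w_{\beta_0}(\eta):=B_{\beta_0}^{-1}e^{-2\beta_0\|\eta\|^2}$. *)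

(* Defs.v *)
From HB Require Import structures.
From mathcomp Require Import all_boot all_order all_algebra sesquilinear.
From mathcomp Require Import all_classical all_reals all_analysis measurable_realfun.

Set Implicit Arguments.
Unset Strict Implicit.
Unset Printing Implicit Defensive.

Import Order.TTheory GRing.Theory Num.Theory.
Import numFieldNormedType.Exports.

Local Open Scope classical_set_scope.
Local Open Scope ring_scope.

(* 'M[R]_(m, n) carries its Borel sigma-algebra. *)
HB.instance Definition _ (R : realType) (m n : nat) :=
  @isMeasurable.Build (sigma_display (@open 'M[R]_(m, n)))
    'M[R]_(m, n) <<s @open 'M[R]_(m, n) >>
    (@sigma_algebra0 _ setT _) (@sigma_algebraC _ _)
    (@sigma_algebra_bigcup _ setT _).

Lemma open_measurable_mx (R : realType) m n (A : set 'M[R]_(m, n)) :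
  open A -> measurable A.
Proof. by move=> oA; exact: sub_sigma_algebra. Qed.

Lemma open_prod_bigcup (T1 T2 : topologicalType) (I : Type) (B : I -> set T1)
    (W : set (T1 * T2)) :
  (forall x U, nbhs x U -> exists i, B i x /\ B i `<=` U) -> open W ->
  W = \bigcup_i (B i `*` [set y | forall x, B i x -> W (x, y)]°).
Proof.
move=> Bb oW; apply/seteqP; split=> [[x y] Wxy|[x y] [i _ [/= Bx]]]; last first.
  by move=> /interior_subset; apply.
have /= [[P Q] /= [Px Qy] PQW] : nbhs (x, y) W by exact: open_nbhs_nbhs.
have [i [Bix BiP]] := Bb _ _ Px.
exists i => //; split => //=.
by apply: filterS Qy => z Qz x' /BiP Px'; apply: PQW.
Qed.

Lemma open_prod_measurable d1 d2 (T1 : measurableType d1)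
    (T2 : measurableType d2) (I : countType) (B : I -> set T1)
    (V : I -> set T2) :
  (forall i, measurable (B i)) -> (forall i, measurable (V i)) ->
  measurable (\bigcup_i (B i `*` V i)).
Proof.
move=> mB mV; apply: countable_bigcupT_measurable; first exact: countableP.
by move=> i; exact: measurableX.
Qed.

(* The product sigma-algebra of 'rV[R]_m * 'rV[R]_n is the Borel one. *)
Lemma rat_ball_basis (R : realType) m n (M : 'M[R]_(m, n)) U : nbhs M U ->
  exists i : 'M[rat]_(m, n) * nat,
    ball (map_mx ratr i.1 : 'M[R]_(m, n)) i.2.+1%:R^-1 M /\
    ball (map_mx ratr i.1 : 'M[R]_(m, n)) i.2.+1%:R^-1 `<=` U.
Proof.
move=> /nbhs_ballP[e /= e0 eU].
have [k ke] : exists k : nat, k.+1%:R^-1 < e / 2.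
  have e20 : 0 < e / 2 by rewrite divr_gt0.
  exists (Num.truncn (e / 2)^-1); rewrite invf_plt ?posrE//.
  exact: truncnS_gt.
have /choice[q qM] : forall ij : 'I_m * 'I_n, exists q : rat,
    ball (M ij.1 ij.2) k.+1%:R^-1 (ratr q).
  move=> [i j]; have [//||r [Mr [q _ qr]]] := @dense_rat R (ball (M i j) k.+1%:R^-1).
  - by exists (M i j); apply: ballxx; rewrite invr_gt0.
  - exact: ball_open.
  by exists q; rewrite qr.
exists (\matrix_(i, j) q (i, j), k); split => /=.
  split; first by rewrite invr_gt0.
  by move=> i j; rewrite !mxE; apply: ball_sym; exact: (qM (i, j)).
move=> N [_ qN]; apply: eU; split => // i j.
apply: (@le_ball _ _ _ (k.+1%:R^-1 + k.+1%:R^-1)).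
  by rewrite [leRHS]splitr lerD// ltW.
apply: ball_triangle (qM (i, j)) _.
by have := qN i j; rewrite !mxE.
Qed.

Lemma measurable_prod_mxE (R : realType) m n p q :
  @measurable _ ('M[R]_(m, n) * 'M[R]_(p, q))%type =
  <<s @open ('M[R]_(m, n) * 'M[R]_(p, q))%type >>.
Proof.
apply/seteqP; split.
  apply: smallest_sub; first exact: smallest_sigma_algebra.
  move=> A [|] [B mB <-].
  - rewrite setTI.
    suff : [set C | <<s @open ('M[R]_(m, n) * 'M[R]_(p, q))%type >>
                      (fst @^-1` C)] B by [].
    apply: mB; split => [|C oC].
      split => /=.
      + exact: sigma_algebra0.
      + by move=> C mC; rewrite setTD preimage_setC; exact: sigma_algebraC.
      + by move=> F mF; rewrite preimage_bigcup; exact: sigma_algebra_bigcup.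
    apply: sub_sigma_algebra; apply: open_comp => // x _; exact: cvg_fst.
  - rewrite setTI.
    suff : [set C | <<s @open ('M[R]_(m, n) * 'M[R]_(p, q))%type >>
                      (snd @^-1` C)] B by [].
    apply: mB; split => [|C oC].
      split => /=.
      + exact: sigma_algebra0.
      + by move=> C mC; rewrite setTD preimage_setC; exact: sigma_algebraC.
      + by move=> F mF; rewrite preimage_bigcup; exact: sigma_algebra_bigcup.
    apply: sub_sigma_algebra; apply: open_comp => // x _; exact: cvg_snd.
apply: smallest_sub.
  split.
  - exact: measurable0.
  - by move=> A mA; rewrite setTD; exact: measurableC.
  - by move=> F mF; exact: bigcupT_measurable.
move=> W oW; rewrite (open_prod_bigcup (@rat_ball_basis R m n) oW).
apply: open_prod_measurable => i; apply: open_measurable_mx.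
- exact: ball_open.
- exact: open_interior.
Qed.

Lemma measurable_fun_coord (R : realType) m n i j :
  measurable_fun setT (fun M : 'M[R]_(m, n) => M i j).
Proof.
apply: (measurability _ (RGenOpens.measurableE R)).
move=> _ [_ [x [y ->]] <-]; rewrite setTI.
apply: open_measurable_mx; apply: open_comp; last exact: interval_open.
by move=> M _; exact: coord_continuous.
Qed.

Definition row_cons (R : realType) n (p : measurableTypeR R * 'rV[R]_n) :
  'rV[R]_n.+1 := row_mx (p.1%:M : 'rV_1) p.2.

Lemma row_consE (R : realType) n (p : measurableTypeR R * 'rV[R]_n) i j :
  row_cons p i j = oapp (p.2 ord0) p.1 (unlift ord0 j).
Proof.
rewrite ord1 /row_cons; case: unliftP => [k ->|->] /=.
  by rewrite -rshift1; exact: row_mxEr.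
have -> : ord0 = lshift n ord0 :> 'I_(1 + n) by exact: val_inj.
by rewrite [LHS]row_mxEl mxE.
Qed.

Lemma measurable_row_cons (R : realType) n :
  measurable_fun setT (@row_cons R n).
Proof.
apply: (@measurability _ _ _ _ _ _ (@open 'rV[R]_n.+1)) => //.
move=> _ [U oU <-]; rewrite setTI.
have oW : @open (R * 'rV[R]_n)%type (@row_cons R n @^-1` U).
  apply: open_comp => // -[x v] _.
  move=> A /nbhs_ballP[e /= e0 eA].
  apply/nbhs_ballP; exists e => //= -[y w] [/= xy [_ vw]].
  apply: eA; split => // i j; rewrite !row_consE.
  by case: unlift => //= k; exact: vw.
have Rb (x : R) V : nbhs x V -> exists i : rat * rat,
    `]ratr i.1, ratr i.2[%classic x /\ `]ratr i.1, ratr i.2[%classic `<=` V.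
  move=> /nbhs_ballP[e /= e0 eV].
  have /rat_in_itvoo[a /itvP aP] : x - e < x by rewrite ltrBlDr ltrDl.
  have /rat_in_itvoo[b /itvP bP] : x < x + e by rewrite ltrDl.
  exists (a, b); split => /=; first by rewrite in_itv/= aP bP.
  move=> y; rewrite /= in_itv/= => /andP[ay yb]; apply: eV.
  rewrite /ball/= distrC ltr_distl (lt_trans _ ay) ?aP//=.
  by rewrite (lt_trans yb) ?bP.
rewrite (open_prod_bigcup Rb oW).
apply: (@open_prod_measurable _ _ (measurableTypeR R)) => i.
- exact: measurable_itv.
- by apply: open_measurable_mx; exact: open_interior.
Qed.

Local Open Scope ereal_scope.

(* Lebesgue measure on 'rV[R]_n, by iterating the product with the
   one-dimensional Lebesgue measure *)
Fixpoint lebesgue_rV (R : realType) (n : nat) : set 'rV[R]_n -> \bar R :=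
  match n with
  | 0 => \d_(0%R : 'rV[R]_0)
  | n'.+1 => pushforward (@lebesgue_measure R \x @lebesgue_rV R n')
                         (@row_cons R n')
  end.
Arguments lebesgue_rV {R n}.

Lemma row_cons_sigma_finite (R : realType) n
    (m : {sigma_finite_measure set 'rV[R]_n -> \bar R}) :
  sigma_finite setT (pushforward (@lebesgue_measure R \x m) (@row_cons R n)).
Proof.
have /sigma_finiteP[F [TF ndF Foo]] := sigma_finiteT (@lebesgue_measure R).
have /sigma_finiteP[G [TG ndG Goo]] := sigma_finiteT m.
pose uncons (v : 'rV[R]_n.+1) : measurableTypeR R * 'rV[R]_n :=
  (v ord0 ord0, rsubmx (v : 'rV[R]_(1 + n))).
have unconsK p : uncons (row_cons p) = p.
  by case: p => x v; rewrite /uncons row_consE unlift_none/= row_mxKr.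
have mu : measurable_fun setT uncons.
  apply/measurable_fun_pairP; split => /=.
    exact: measurable_fun_coord.
  apply: (@measurability _ _ _ _ _ _ (@open 'rV[R]_n)) => //.
  move=> _ [U oU <-]; rewrite setTI; apply: open_measurable_mx.
  by apply: open_comp => // v _; exact: continuous_rsubmx.
exists (fun k => uncons @^-1` (F k `*` G k)).
  apply/esym; rewrite -subTset => v _ /=.
  have [i _ Fi] : (\bigcup_k F k) (uncons v).1 by rewrite -TF.
  have [j _ Gj] : (\bigcup_k G k) (uncons v).2 by rewrite -TG.
  exists (maxn i j) => //; split.
  - by move: Fi; exact/subsetPset/ndF/leq_maxl.
  - by move: Gj; exact/subsetPset/ndG/leq_maxr.
move=> k; have [mFk Fk] := Foo k; have [mGk Gk] := Goo k; split.
  by rewrite -[X in measurable X]setTI; apply: mu => //; exact: measurableX.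
rewrite /pushforward -comp_preimage.
have -> : uncons \o @row_cons R n = id by apply/funext => p /=.
by rewrite preimage_id product_measure1E// lte_mul_pinfty// ge0_fin_numE.
Qed.

Definition as_sigma_finite d (T : measurableType d) (R : realType)
    (m : {measure set T -> \bar R}) (sf : sigma_finite setT m) :
  set T -> \bar R := m.

HB.instance Definition _ d (T : measurableType d) (R : realType)
    (m : {measure set T -> \bar R}) (sf : sigma_finite setT m) :=
  Measure.copy (as_sigma_finite sf) m.

HB.instance Definition _ d (T : measurableType d) (R : realType)
    (m : {measure set T -> \bar R}) (sf : sigma_finite setT m) :=
  Measure_isSigmaFinite.Build _ _ _ (as_sigma_finite sf) sf.

Lemma lebesgue_rV_measure (R : realType) n :
  exists m : {sigma_finite_measure set 'rV[R]_n -> \bar R},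
    lebesgue_rV = m :> (set 'rV[R]_n -> \bar R).
Proof.
elim: n => [|n [m mE]].
  by exists (\d_(0%R : 'rV[R]_0)).
pose f := [the measure _ _ of
  pushforward (@lebesgue_measure R \x m) (@row_cons R n)].
pose mf := f (@measurable_row_cons R n).
pose sf := @as_sigma_finite _ _ _ mf (@row_cons_sigma_finite R n m).
by exists sf; rewrite /= mE.
Qed.

Lemma lebesgue_rV0 (R : realType) n : @lebesgue_rV R n set0 = 0.
Proof. by have [m ->] := lebesgue_rV_measure R n; exact: measure0. Qed.

Lemma lebesgue_rV_ge0 (R : realType) n : forall A, 0 <= @lebesgue_rV R n A.
Proof. by have [m ->] := lebesgue_rV_measure R n; exact: measure_ge0. Qed.

Lemma lebesgue_rV_sigma_additive (R : realType) n : semi_sigma_additive (@lebesgue_rV R n).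
Proof. by have [m ->] := lebesgue_rV_measure R n; exact: measure_semi_sigma_additive. Qed.

Lemma lebesgue_rV_sigma_finite (R : realType) n : sigma_finite setT (@lebesgue_rV R n).
Proof. by have [m ->] := lebesgue_rV_measure R n; exact: sigma_finiteT. Qed.

HB.instance Definition _ (R : realType) n :=
  isMeasure.Build _ _ _ (@lebesgue_rV R n) (lebesgue_rV0 R n)
    (@lebesgue_rV_ge0 R n) (@lebesgue_rV_sigma_additive R n).

HB.instance Definition _ (R : realType) n :=
  Measure_isSigmaFinite.Build _ _ _ (@lebesgue_rV R n)
    (@lebesgue_rV_sigma_finite R n).

Lemma lebesgue_rV_box (R : realType) n (A : 'I_n -> set (measurableTypeR R)) :
  (forall i, measurable (A i)) ->
  lebesgue_rV [set v : 'rV[R]_n | forall i, A i (v ord0 i)] =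
  \prod_(i < n) lebesgue_measure (A i).
Proof.
elim: n A => [|n IHn] A mA.
  by rewrite big_ord0 /= diracE mem_set// => -[].
rewrite big_ord_recl -IHn//= /pushforward.
have [m mE] := lebesgue_rV_measure R n; rewrite mE.
rewrite -product_measure1E//; last first.
  rewrite [X in measurable X](_ : _ =
      \bigcap_(i in [set: 'I_n]) ((fun v : 'rV[R]_n => v ord0 i) @^-1`
        A (lift ord0 i))); last first.
    apply/seteqP; split => v /= h i; first by move=> _; exact: h.
    exact: (h i I).
  apply: fin_bigcap_measurable => // i _.
  have := @measurable_fun_coord R 1 n ord0 i measurableT _ (mA (lift ord0 i)).
  by rewrite setTI.
congr (product_measure1 _ _ _); apply/seteqP; split => -[x v] /=.
  move=> h; split; first by have := h ord0; rewrite row_consE unlift_none.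
  by move=> i; have := h (lift ord0 i); rewrite row_consE liftK.
move=> [Ax Av] i; rewrite row_consE.
by case: unliftP => [k ->|->].
Qed.

Definition density d (T : measurableType d) (R : realType)
    (mu : {measure set T -> \bar R}) (f : T -> \bar R)
    (mf : measurable_fun setT f) (f0 : forall x, 0 <= f x) (A : set T) :=
  \int[mu]_(x in A) f x.

Lemma density0 d (T : measurableType d) (R : realType)
    (mu : {measure set T -> \bar R}) (f : T -> \bar R)
    (mf : measurable_fun setT f) (f0 : forall x, 0 <= f x) :
  density mu mf f0 set0 = 0.
Proof. exact: integral_set0. Qed.

Lemma density_ge0 d (T : measurableType d) (R : realType)
    (mu : {measure set T -> \bar R}) (f : T -> \bar R)
    (mf : measurable_fun setT f) (f0 : forall x, 0 <= f x) A :
  0 <= density mu mf f0 A.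
Proof. by apply: integral_ge0 => x _; exact: f0. Qed.

HB.instance Definition _ d (T : measurableType d) (R : realType)
    (mu : {measure set T -> \bar R}) (f : T -> \bar R)
    (mf : measurable_fun setT f) (f0 : forall x, 0 <= f x) :=
  isMeasure.Build _ _ _ (density mu mf f0) (density0 mu mf f0)
    (density_ge0 mu mf f0) (@semi_sigma_additive_nng_induced _ _ _ mu f mf f0).

Local Close Scope ereal_scope.

Definition dot_norm (R : realType) n (dot : {dot 'rV[R]_n for @idfun R})
  (z : 'rV[R]_n) : R := Num.sqrt (dot z z).

(* [B_beta] *)
Definition gauss_mass (R : realType) n (dot : {dot 'rV[R]_n for @idfun R})
    (beta : R) : R :=
  \int[@lebesgue_rV R n]_xi expR (- beta * dot_norm dot xi ^+ 2).

(* [w_beta] *)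
Definition gauss_weight (R : realType) n (dot : {dot 'rV[R]_n for @idfun R})
    (beta : R) (p : 'rV[R]_n * 'rV[R]_n) : R :=
  (gauss_mass dot beta)^-1 * expR (- beta * dot_norm dot (p.1 - p.2) ^+ 2).

(* [\bar w_beta] *)
Definition gauss_weight_bar (R : realType) n
    (dot : {dot 'rV[R]_n for @idfun R}) (beta : R) (eta : 'rV[R]_n) : R :=
  (gauss_mass dot beta)^-1 * expR (- (2 * beta) * dot_norm dot eta ^+ 2).

Lemma gauss_weight_ge0 (R : realType) n (dot : {dot 'rV[R]_n for @idfun R})
  beta p : (0 <= (gauss_weight dot beta p)%:E)%E.
Proof.
rewrite lee_fin mulr_ge0 ?expR_ge0// invr_ge0.
by apply: Rintegral_ge0 => x _; exact: expR_ge0.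
Qed.

Lemma dotE (R : realType) n (dot : {dot 'rV[R]_n for @idfun R}) (z : 'rV[R]_n) :
  dot z z = \sum_i \sum_j z ord0 i * (z ord0 j *
    dot (delta_mx ord0 i) (delta_mx ord0 j)).
Proof.
rewrite {1 2}(row_sum_delta z) linear_sumlz; apply: eq_bigr => i _.
rewrite linear_sumr; apply: eq_bigr => j _.
by rewrite linearZl_LR linearZr_LR.
Qed.

Lemma measurable_gauss_weight (R : realType) n
  (dot : {dot 'rV[R]_n for @idfun R}) beta :
  measurable_fun setT (fun p => (gauss_weight dot beta p)%:E).
Proof.
have mc i : measurable_fun setT
    (fun p : 'rV[R]_n * 'rV[R]_n => (p.1 - p.2) ord0 i).
  under eq_fun do rewrite !mxE.
  apply: measurable_funB.
  - exact: (measurableT_comp (@measurable_fun_coord R 1 n ord0 i)).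
  - exact: (measurableT_comp (@measurable_fun_coord R 1 n ord0 i)).
have md : measurable_fun setT
    (fun p : 'rV[R]_n * 'rV[R]_n => dot (p.1 - p.2) (p.1 - p.2)).
  under eq_fun do rewrite dotE.
  apply: measurable_sum => i; apply: measurable_sum => j.
  by apply: measurable_funM => //; apply: measurable_funM.
have ms := measurableT_comp (continuous_measurable_fun (@sqrt_continuous R)) md.
apply/measurable_EFinP; apply: measurable_funM => //.
apply: measurableT_comp => //; apply: measurable_funM => //.
exact: measurable_funX.
Qed.

(* [mu_beta = w_beta mu] *)
Definition thermalized (R : realType) n (dot : {dot 'rV[R]_n for @idfun R})
    (mu : {measure set ('rV[R]_n * 'rV[R]_n) -> \bar R}) (beta : R) :
    {measure set ('rV[R]_n * 'rV[R]_n) -> \bar R} :=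
  density mu (measurable_gauss_weight dot beta) (gauss_weight_ge0 dot beta).

(* [S_lambda] *)
Definition scaled_rotation (R : realType) n (lambda : R)
    (p : 'rV[R]_n * 'rV[R]_n) : 'rV[R]_n * 'rV[R]_n :=
  ((Num.sqrt 2)^-1 *: (p.1 + lambda^-1 *: p.2),
   (Num.sqrt 2)^-1 *: (p.1 - lambda^-1 *: p.2)).

Definition radon (R : realType) n
    (mu : {measure set ('rV[R]_n * 'rV[R]_n) -> \bar R}) : Prop :=
  (forall K, compact K -> (mu K < +oo)%E) /\
  (forall A, measurable A ->
    mu A = ereal_sup [set mu K | K in [set K | compact K /\ K `<=` A]]).

Definition finite_radon (R : realType) n
    (mu : {measure set ('rV[R]_n * 'rV[R]_n) -> \bar R}) : Prop :=
  radon mu /\ (mu setT < +oo)%E.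

Definition bounded_continuous (R : realType) (X : topologicalType)
  (f : X -> R) : Prop := continuous f /\ bounded_fun f.

(* Weak convergence in [M_b] of [nu beta] to [nu_lim] as [beta] tends to [+oo];
   [nu beta] need only belong to [M_b] for large [beta]. *)
Definition weak_cvg (R : realType) n
    (nu : R -> {measure set ('rV[R]_n * 'rV[R]_n) -> \bar R})
    (nu_lim : {measure set ('rV[R]_n * 'rV[R]_n) -> \bar R}) : Prop :=
  [/\ \forall beta \near +oo, finite_radon (nu beta),
      finite_radon nu_lim &
      forall f : 'rV[R]_n * 'rV[R]_n -> R, bounded_continuous f ->
        (\int[nu beta]_p (f p)%:E)%E @[beta --> +oo] -->
        (\int[nu_lim]_p (f p)%:E)%E].

(* Measurability in [L^1_loc] is with respect to the completed Lebesgue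
   sigma-algebra, hence the Borel version [L']. *)
Definition loc_integrable (R : realType) n
    (L : 'rV[R]_n * 'rV[R]_n -> R) : Prop :=
  exists2 L' : 'rV[R]_n * 'rV[R]_n -> R,
    {ae (lebesgue_rV \x lebesgue_rV)%E, forall p, L p = L' p} &
    measurable_fun setT L' /\
    forall K, compact K ->
      (lebesgue_rV \x lebesgue_rV)%E.-integrable K (EFin \o L').

(* Main.v *)
(* Put lambda = sqrt (beta / beta0).  The substitution p = S_lambda (xi, eta)
   has Jacobian lambda^-2N, which is also the ratio B_beta / B_beta0, and turns
   w_beta into the beta-free weight \bar w_beta0(eta).  Hence
     mu_beta(f) = \int f (S_lambda (xi, eta)) \bar w_beta0(eta)
                      L (S_lambda (xi, eta)) dxi deta,
   and dominated convergence with majorant sup |f| * g gives the limit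
     \int f (xi / sqrt 2, xi / sqrt 2) \bar w_beta0(eta) \hat L (xi / sqrt 2).
   The integral of \bar w_beta0 is 2^-N, which compensates the rescaling of xi.
   Two points are hidden in the informal statement: \hat L coincides a.e. with a
   Borel function, because almost every section in eta of the pointwise limit
   does; and the measures involved are Radon, because every finite Borel measure
   on a finite-dimensional space is. *)

Require Import Defs.
From mathcomp Require Import all_boot all_order all_algebra sesquilinear.
From mathcomp Require Import all_classical all_reals all_analysis measurable_realfun.
From mathcomp Require Import ring.
Import Order.TTheory GRing.Theory Num.Theory.
Import numFieldNormedType.Exports.
Local Open Scope classical_set_scope.
Local Open Scope ring_scope.

Set Implicit Arguments.
Unset Strict Implicit.
Unset Printing Implicit Defensive.

(** * Integrals of almost everywhere equal functions and integrals against a density *)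

Section integrals.
Local Open Scope ereal_scope.
Context d (T : measurableType d) (R : realType).
Variable mu : {measure set T -> \bar R}.

Import HBNNSimple.

(* Only [g] has to be measurable: the integral of a nonnegative function is
   defined as a supremum over the simple functions below it. *)
Lemma ge0_ae_eq_integral_r (f g : T -> \bar R) :
  (forall x, 0 <= f x) -> (forall x, 0 <= g x) -> measurable_fun setT g ->
  {ae mu, forall x, f x = g x} -> \int[mu]_x f x = \int[mu]_x g x.
Proof.
move=> f0 g0 mg [M [mM M0 fgM]].
have fgNM x : (~` M) x -> f x = g x.
  by move=> Mx; apply: contrapT => ?; apply/Mx/fgM.
apply/eqP; rewrite eq_le; apply/andP; split.
  (* A simple function below [f] is measurable and lies below [g] off the null set [M]; this bounds
     its integral although [f] itself may fail to be measurable. *)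
  rewrite ge0_integralTE//; apply: ge_ereal_sup => _ [h /= hf <-].
  rewrite -integralT_nnsfun; apply: ae_ge0_le_integral => //.
  - by move=> x _; rewrite lee_fin.
  - exact/measurable_EFinP.
  - exists M; split => // x /= hx; apply: contrapT => Mx; apply: hx => _.
    by rewrite -fgNM.
(* Conversely, [g] set to zero on [M] lies below [f] everywhere, so every simple function below it
   competes in the supremum for [f]. *)
rewrite (ge0_negligible_integral mM measurableT mg)// setTD.
rewrite integral_mkcond ge0_integralTE; last first.
  by move=> x; rewrite patchE; case: ifP.
rewrite [leRHS]ge0_integralTE//; apply: ereal_sup_le => /= _ [h hg <-].
exists h => //= x; apply: le_trans (hg x) _.
by rewrite patchE; case: ifPn => // /set_mem /fgNM ->.
Qed.

Lemma ae_eq_integral_r (f g : T -> \bar R) : measurable_fun setT g ->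
  {ae mu, forall x, f x = g x} -> \int[mu]_x f x = \int[mu]_x g x.
Proof.
move=> mg fg; rewrite integralE [RHS]integralE; congr (_ - _).
- apply: ge0_ae_eq_integral_r => //; first exact: measurable_funepos.
  by apply: filterS fg => x fg; rewrite !funeposE fg.
- apply: ge0_ae_eq_integral_r => //; first exact: measurable_funeneg.
  by apply: filterS fg => x fg; rewrite !funenegE fg.
Qed.

Variables (w : T -> R) (mw : measurable_fun setT (fun x => (w x)%:E)).
Hypothesis w0 : forall x, 0 <= (w x)%:E.

Let integral_density_nnsfun (h : {nnsfun T >-> R}) :
  \int[density mu mw w0]_x (h x)%:E = \int[mu]_x ((h x)%:E * (w x)%:E).
Proof.
have mh r : measurable (h @^-1` [set r]) by exact: measurable_sfunP.
rewrite integralT_nnsfun sintegralE.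
(* Decompose [h] along its finitely many level sets; the density measure of each is the integral of
   [w] over it. *)
transitivity (\int[mu]_x
    \sum_(r \in range h) (r%:E * ((\1_(h @^-1` [set r]) x)%:E * (w x)%:E))).
  rewrite ge0_integral_fsum//; last 2 first.
  - move=> r; apply: measurable_funeM; apply: emeasurable_funM => //.
    exact/measurable_EFinP.
  - move=> r x _; rewrite muleA mule_ge0// -EFinM.
    exact: nnfun_muleindic_ge0.
  apply: eq_fsbigr => r /[!inE] -[t _ <-].
  rewrite ge0_integralZl//; last 3 first.
  - by apply: emeasurable_funM => //; exact/measurable_EFinP.
  - by move=> x _; rewrite mule_ge0// lee_fin.
  - by rewrite lee_fin.
  congr *%E; rewrite /= /density integral_mkcond; apply: eq_integral => x _.
  by rewrite patchE indicE; case: ifP => _; rewrite ?mul1e ?mul0e.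
apply: eq_integral => x _; rewrite fimfunE -fsumEFin// ge0_mule_fsuml.
  by apply: eq_fsbigr => r _; rewrite EFinM muleA.
by move=> r; rewrite nnfun_muleindic_ge0.
Qed.

(** Monotone convergence along simple functions increasing to [h], applied on both sides. *)
Lemma ge0_integral_density (h : T -> \bar R) :
  measurable_fun setT h -> (forall x, 0 <= h x) ->
  \int[density mu mw w0]_x h x = \int[mu]_x (h x * (w x)%:E).
Proof.
move=> mh h0; pose h_ := nnsfun_approx measurableT mh.
have hcvg x : (h_ n x)%:E @[n --> \oo] --> h x by exact: cvg_nnsfun_approx.
transitivity (limn (fun n => \int[density mu mw w0]_x (h_ n x)%:E)).
  rewrite -monotone_convergence//=.
  - by apply: eq_integral => x _; apply/esym/cvg_lim => //=.
  - by move=> n; exact/measurable_EFinP.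
  - by move=> n x _; rewrite lee_fin.
  - by move=> x _ a b ab; rewrite lee_fin//; exact/lefP/nd_nnsfun_approx.
under eq_fun do rewrite integral_density_nnsfun.
rewrite -monotone_convergence//=.
- by apply: eq_integral => x _; apply/cvg_lim => //=; exact: cvgeMr.
- by move=> n; apply: emeasurable_funM => //; exact/measurable_EFinP.
- by move=> n x _; rewrite mule_ge0// lee_fin.
- move=> x _ a b ab; rewrite lee_wpmul2r// lee_fin.
  exact/lefP/nd_nnsfun_approx.
Qed.

End integrals.

Lemma ae_eq_integral_set_r d (T : measurableType d) (R : realType)
    (mu : {measure set T -> \bar R}) (A : set T) (f g : T -> \bar R) :
  measurable A -> measurable_fun setT g -> {ae mu, forall x, f x = g x} ->
  (\int[mu]_(x in A) f x = \int[mu]_(x in A) g x)%E.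
Proof.
move=> mA mg fg; rewrite integral_mkcond [RHS]integral_mkcond.
apply: ae_eq_integral_r.
  by apply/(measurable_restrictT _ mA); exact: measurable_funTS.
by apply: filterS fg => x fg; rewrite !patchE fg.
Qed.

(* Mathcomp-Analysis makes [pushforward m f] a measure from [mf], which cannot
   be inferred from [f]. *)
Definition image_measure d d' (T1 : measurableType d) (T2 : measurableType d')
    (R : realFieldType) (m : {measure set T1 -> \bar R}) (f : T1 -> T2)
    (mf : measurable_fun setT f) : {measure set T2 -> \bar R} :=
  measure_function_pushforward__canonical__measure_function_Measure m mf.

(** * Finite Borel measures on the product space are Radon *)

Lemma normr_coord_le (R : realType) m n (M : 'M[R]_(m, n)) i j :
  `|M i j| <= `|M|.
Proof.
rewrite [leRHS]/Num.Def.normr/= mx_normrE.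
exact: (le_bigmax _ (fun ij => `|M ij.1 ij.2|) (i, j)).
Qed.

Section finite_measure_radon.
Local Open Scope ereal_scope.
Context (R : realType) (n : nat).
Local Notation T := ('rV[R]_n * 'rV[R]_n)%type.

Lemma open_measurable_prod (A : set T) : open A -> measurable A.
Proof. by move=> oA; rewrite measurable_prod_mxE; exact: sub_sigma_algebra. Qed.

Lemma closed_measurable_prod (A : set T) : closed A -> measurable A.
Proof.
by move=> cA; rewrite -(setCK A); apply: measurableC;
  apply: open_measurable_prod; exact: closed_openC.
Qed.

Variables (mu : {measure set T -> \bar R}) (mu_fin : mu setT < +oo).

Let lty (A : set T) : measurable A -> mu A < +oo.
Proof.
by move=> mA; apply: le_lt_trans mu_fin; apply: le_measure; rewrite ?inE.
Qed.

(** Continuity from above, available because [mu] is finite. *)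
Lemma nonincreasing_small_measure (G : (set T)^nat) e : (0 < e)%R ->
  (forall k, measurable (G k)) -> nonincreasing_seq G ->
  \bigcap_k G k = set0 -> exists k, mu (G k) <= e%:E.
Proof.
move=> e0 mG ndG G0.
have : mu \o G @ \oo --> mu (\bigcap_k G k).
  by apply: nonincreasing_cvg_mu => //; [exact: lty|rewrite G0].
rewrite G0 measure0 => /(_ [set x | x < e%:E])[|k _ kG].
  by apply: open_ereal_lt'; rewrite lte_fin.
by exists k; apply: ltW; exact: (kG k (leqnn k)).
Qed.

(** Inner approximation by closed sets and outer approximation by open sets are required together,
    so that the property is stable under complements. *)
Definition closed_open_approx (A : set T) := forall e, (0 < e)%R ->
  exists F U, [/\ closed F, open U, F `<=` A, A `<=` U & mu (U `\` F) <= e%:E].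

(** The outer approximant is [U] itself; the inner one removes the open [1 / (k + 1)]-neighbourhood
    of the complement. *)
Lemma closed_open_approx_open (U : set T) : open U -> closed_open_approx U.
Proof.
move=> oU e e0.
pose V k : set T := \bigcup_(y in ~` U) ball y k.+1%:R^-1.
have oV k : open (V k) by apply: bigcup_open => y _; exact: ball_open.
have [k Vk] : exists k, mu (U `&` V k) <= e%:E.
  apply: nonincreasing_small_measure => //.
  - by move=> k; apply: measurableI; exact: open_measurable_prod.
  - move=> k l kl; apply/subsetPset; apply: setIS => x [y Uy xy].
    exists y => //; apply: le_ball xy.
    by rewrite lef_pV2 ?posrE ?ler_nat.
  - rewrite -subset0 => x UVx; have [Ux _] := UVx 0%N I.
    have /nbhs_ballP[r /= r0 rU] : nbhs x U by exact: open_nbhs_nbhs.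
    have [k kr] : exists k, (k.+1%:R^-1 < r)%R.
      exists (Num.truncn r^-1); rewrite invf_plt ?posrE//.
      exact: truncnS_gt.
    have [_ [y Uy xy]] := UVx k I; apply: Uy; apply: rU.
    by apply: le_ball (ball_sym xy); exact: ltW.
exists (~` V k), U; split => //.
- exact: open_closedC.
- move=> x Vx; apply: contrapT => Ux; apply: Vx; exists x => //.
  by apply: ballxx; rewrite invr_gt0.
- by rewrite setDE setCK.
Qed.

(** Complementation exchanges the closed and the open approximant and keeps their difference. *)
Lemma closed_open_approxC (A : set T) :
  closed_open_approx A -> closed_open_approx (~` A).
Proof.
move=> hA e /hA[F [U [cF oU FA AU mUF]]]; exists (~` U), (~` F); split.
- exact: open_closedC.
- exact: closed_openC.
- exact: subsetC.
- exact: subsetC.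
- by rewrite setDE setCK setIC -setDE.
Qed.

(** The errors of the pieces sum to [e / 2]. An infinite union of closed sets need not be closed, so
    only finitely many are kept; the other [e / 2] pays for the rest. *)
Lemma closed_open_approx_bigcup (A : (set T)^nat) :
  (forall k, closed_open_approx (A k)) -> closed_open_approx (\bigcup_k A k).
Proof.
move=> hA e e0; have e20 : (0 < e / 2)%R by rewrite divr_gt0.
have /choice[FU FUP] : forall k, exists FU : set T * set T,
    [/\ closed FU.1, open FU.2, FU.1 `<=` A k, A k `<=` FU.2 &
      mu (FU.2 `\` FU.1) <= (e / 2 / (2 ^ k.+1)%:R)%:E].
  move=> k; have [|F [U FUP]] := hA k (e / 2 / (2 ^ k.+1)%:R)%R.
    by rewrite divr_gt0// ltr0n expn_gt0.
  by exists (F, U).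
pose F k := (FU k).1; pose U k := (FU k).2.
have cF k : closed (F k) by have [] := FUP k.
have oU k : open (U k) by have [] := FUP k.
have mF k : measurable (F k) by exact: closed_measurable_prod.
have mU k : measurable (U k) by exact: open_measurable_prod.
pose G k := \bigcup_(i < k) F i.
have cG k : closed (G k).
  by rewrite /G bigcup_mkord; apply: closed_bigsetU => i _; exact: cF.
have mG k : measurable (G k) by exact: closed_measurable_prod.
have mbF : measurable (\bigcup_k F k) by exact: bigcupT_measurable.
have oUU : open (\bigcup_k U k) by exact: bigcup_open.
have mbU : measurable (\bigcup_k U k) by exact: open_measurable_prod.
have [k Gk] : exists k, mu (\bigcup_k F k `\` G k) <= (e / 2)%:E.
  apply: nonincreasing_small_measure => //.
  - by move=> k; exact: measurableD.
  - move=> k l kl; apply/subsetPset; apply: setDS => x [i /= ik Fx].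
    by exists i => //=; exact: leq_trans ik kl.
  - rewrite -subset0 => x h; have [[i _ Fx] _] := h 0%N I.
    have [_] := h i.+1 I; apply; exists i => //=.
exists (G k), (\bigcup_k U k); split => //.
- by move=> x [i _ Fx]; exists i => //; have [_ _ + _ _] := FUP i; apply.
- by move=> x [i _ Ax]; exists i => //; have [_ _ _ + _] := FUP i; apply.
rewrite [e]splitr EFinD.
apply: (@le_trans _ _ (mu ((\bigcup_k U k `\` \bigcup_k F k) `|`
                           (\bigcup_k F k `\` G k)))).
  apply: le_measure; rewrite ?inE.
  - exact: measurableD.
  - by apply: measurableU; exact: measurableD.
  - move=> x [Ux Gx]; have [Fx|Fx] := pselect ((\bigcup_k F k) x).
      by right.
    by left.
apply: le_trans (measureU2 _ _ _) _; try exact: measurableD.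
apply: leeD => //.
apply: (@le_trans _ _ (\sum_(i <oo) mu (U i `\` F i))).
  apply: measure_sigma_subadditive.
  - by move=> i; exact: measurableD.
  - exact: measurableD.
  - move=> x [[i _ Ux] Fx]; exists i => //; split => // Fix.
    by apply: Fx; exists i.
apply: le_trans (epsilon_trick0 xpredT (ltW e20)).
by apply: lee_nneseries => i _ //; have [] := FUP i.
Qed.

(** The approximable sets form a sigma-algebra containing the open sets, and the product
    sigma-algebra is the Borel one. *)
Lemma measurable_closed_open_approx (A : set T) :
  measurable A -> closed_open_approx A.
Proof.
rewrite measurable_prod_mxE => mA.
suff : [set B | closed_open_approx B] A by [].
apply: mA; split; last exact: closed_open_approx_open.
split => /=.
- by apply: closed_open_approx_open; exact: open0.
- by move=> B hB; rewrite setTD; exact: closed_open_approxC.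
- by move=> B hB; exact: closed_open_approx_bigcup.
Qed.

(** A measurable set contains a closed [F] of nearly full measure, and [F] is the increasing union
    of its compact intersections with cubes. *)
Lemma finite_measure_radon : finite_radon mu.
Proof.
have mK (K : set T) : compact K -> measurable K.
  move=> cK; apply: closed_measurable_prod; apply: compact_closed cK.
  exact: norm_hausdorff.
split=> //; split=> [K /mK/lty//|A mA].
apply/eqP; rewrite eq_le; apply/andP; split; last first.
  apply: ge_ereal_sup => _ [K [cK KA] <-].
  by apply: le_measure => //; rewrite inE//; exact: mK.
apply/lee_addgt0Pr => e e0.
have [F [U [cF oU FA AU mUF]]] := measurable_closed_open_approx mA e0.
have mF := closed_measurable_prod cF; have mU := open_measurable_prod oU.
pose I k := [set v : 'rV[R]_n | forall i, v ord0 i \in `[- k%:R, k%:R]%R].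
pose B k : set T := F `&` (I k `*` I k).
have cB k : compact (B k).
  rewrite /B setIC; apply: compact_closedI => //.
  suff cI : compact (I k) by exact: compact_setX.
  apply: (@rV_compact R n (fun=> [set` `[- k%:R, k%:R]%R])) => i.
  exact: segment_compact.
have ndB : nondecreasing_seq B.
  have ndI k l : (k <= l)%N -> I k `<=` I l.
    move=> kl v h i; move: (h i); rewrite !in_itv/= => /andP[h1 h2].
    rewrite (le_trans _ h1) ?(le_trans h2) ?lerN2 ?ler_nat//.
  move=> k l kl; apply/subsetPset; apply: setIS => -[x y] [/= Ix Iy].
  by split; exact: ndI kl _ _.
have UB : \bigcup_k B k = F.
  apply/seteqP; split => [x [k _ []]//|[x y] Fxy].
  have [k kP] : exists k : nat, forall i, (`|x ord0 i| <= k%:R)%R /\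
      (`|y ord0 i| <= k%:R)%R.
    exists (Num.truncn (`|x| + `|y|)).+1 => i.
    have h : (`|x| + `|y| <= (Num.truncn (`|x| + `|y|)).+1%:R)%R.
      by apply: ltW; exact: truncnS_gt.
    split; apply: le_trans h.
    - by apply: ler_wpDr => //; exact: normr_coord_le.
    - by apply: ler_wpDl => //; exact: normr_coord_le.
  exists k => //; split => //; split => i /=; rewrite in_itv/= -ler_norml.
  - exact: (kP i).1.
  - exact: (kP i).2.
have cvB : mu \o B @ \oo --> mu F.
  rewrite -UB; apply: nondecreasing_cvg_mu => //.
  - by move=> k; exact: mK.
  - by rewrite UB.
rewrite (measureDI mu mA mF) (setIidr FA) addeC; apply: leeD; last first.
  apply: le_trans mUF; apply: le_measure; rewrite ?inE.
  - exact: measurableD.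
  - exact: measurableD.
  - exact: setSD.
apply: (@le_trans _ _ (limn (mu \o B))); first by rewrite (cvg_lim _ cvB).
 apply: lime_le; first exact: (cvgP _ cvB).
apply: nearW => k /=; apply: ereal_sup_ubound; exists (B k) => //; split => //.
by apply: subset_trans FA => x [].
Qed.

End finite_measure_radon.

(** * Affine changes of variables and the rotation [S_lambda] *)

Lemma continuous_affine (K : numFieldType) (V : normedModType K) (c : K) (a : V) :
  continuous (fun v : V => c *: v + a).
Proof.
move=> v; apply: cvgD; last exact: cvg_cst.
by apply: cvgZ; [exact: cvg_cst|exact: cvg_id].
Qed.

Lemma continuous_lincomb (K : numFieldType) (V : normedModType K) (a b : K) :
  continuous (fun p : V * V => a *: p.1 + b *: p.2).
Proof.
move=> p; apply: cvgD; apply: cvgZ;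
  by [exact: cvg_cst|exact: cvg_fst|exact: cvg_snd].
Qed.
Section affine_change_of_variables.
Local Open Scope ereal_scope.
Context (R : realType).

Lemma continuous_measurable_rV m n (f : 'rV[R]_m -> 'rV[R]_n) :
  continuous f -> measurable_fun setT f.
Proof.
move=> cf; apply: (@measurability _ _ _ _ _ _ (@open 'rV[R]_n)) => //.
move=> _ [U oU <-]; rewrite setTI; apply: open_measurable_mx.
by apply: open_comp => // x _; exact: cf.
Qed.

Lemma measurable_affine n (c : R) (a : 'rV[R]_n) :
  measurable_fun setT (fun v : 'rV[R]_n => (c *: v + a)%R).
Proof.
apply: continuous_measurable_rV; exact: continuous_affine.
Qed.

Lemma measurable_lincomb n (a b : R) : measurable_fun setT
  (fun p : 'rV[R]_n * 'rV[R]_n => (a *: p.1 + b *: p.2)%R).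
Proof.
apply: (@measurability _ _ _ _ _ _ (@open 'rV[R]_n)) => //.
move=> _ [U oU <-]; rewrite setTI; apply: open_measurable_prod.
by apply: open_comp => // p _; exact: continuous_lincomb.
Qed.

Lemma measurable_scaled_rotation n (lambda : R) :
  measurable_fun setT (@scaled_rotation R n lambda).
Proof.
apply/measurable_fun_pairP; split.
- rewrite (_ : _ \o _ = (fun p : 'rV[R]_n * 'rV[R]_n =>
    ((Num.sqrt 2)^-1 *: p.1 + (Num.sqrt 2)^-1 / lambda *: p.2)%R)).
    exact: measurable_lincomb.
  by apply/funext => p /=; rewrite scalerDr scalerA.
- rewrite (_ : _ \o _ = (fun p : 'rV[R]_n * 'rV[R]_n =>
    ((Num.sqrt 2)^-1 *: p.1 + (- ((Num.sqrt 2)^-1 / lambda)) *: p.2)%R)).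
    exact: measurable_lincomb.
  by apply/funext => p /=; rewrite scalerBr scalerA scaleNr.
Qed.

Let aff (c a : R) (x : measurableTypeR R) : measurableTypeR R := (c * x + a)%R.

Let measurable_aff c a : measurable_fun setT (aff c a).
Proof. by apply: measurable_funD => //; exact: measurable_funM. Qed.

Let scaled_aff_image (c a : R) :
    {measure set (measurableTypeR R) -> \bar R} :=
  mscale (NngNum (normr_ge0 c))
    (image_measure (@lebesgue_measure R) (measurable_aff c a)).

(** Both measures agree on half-open intervals, which determine Lebesgue measure. *)
Let lebesgue_measure_affine (c a : R) (A : set (measurableTypeR R)) :
  c != 0%R -> measurable A -> lebesgue_measure A = scaled_aff_image c a A.
Proof.
move=> c0 mA.
rewrite (@lebesgue_measure_unique R (scaled_aff_image c a))// => _ [[u v] _ <-]/=.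
rewrite /mscale/= /pushforward/=.
have [cp|cn|c00] := ltgtP 0%R c; last by rewrite -c00 eqxx in c0.
- rewrite (_ : _ @^-1` _ = `]((u - a) / c)%R, ((v - a) / c)%R]%classic); last first.
    apply/seteqP; split => x /=; rewrite !in_itv/= ltr_pdivrMr// ler_pdivlMr//;
    by rewrite ltrBlDr lerBrDr mulrC.
  rewrite !lebesgue_measure_itv/= !lte_fin ltr_pM2r ?invr_gt0// ltrD2r.
  case: ifP => _; last by rewrite mule0.
  rewrite -!EFinD -EFinM gtr0_norm//; congr EFin.
  by rewrite -mulrBl mulrCA mulfV// mulr1; ring.
(* For negative [c] the endpoints are exchanged and the closed end moves to the left. *)
- rewrite (_ : _ @^-1` _ = `[((v - a) / c)%R, ((u - a) / c)%R[%classic); last first.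
    apply/seteqP; split => x /=;
    rewrite !in_itv/= ltr_ndivlMr// ler_ndivrMr// andbC ltrBlDr lerBrDr mulrC//.
  rewrite !lebesgue_measure_itv/= !lte_fin ltr_nM2r ?invr_lt0// ltrD2r.
  case: ifP => _; last by rewrite mule0.
  rewrite -!EFinD -EFinM ltr0_norm//; congr EFin.
  by rewrite -mulrBl mulNr mulrCA mulfV// mulr1; ring.
Qed.

Lemma ge0_integral_lebesgue_affine (c a : R) (h : measurableTypeR R -> \bar R) :
  c != 0%R -> measurable_fun setT h -> (forall x, 0 <= h x) ->
  `|c|%:E * \int[lebesgue_measure]_x h (aff c a x) =
  \int[lebesgue_measure]_x h x.
Proof.
move=> c0 mh h0.
rewrite [RHS](eq_measure_integral (scaled_aff_image c a)); last first.
  by move=> A mA _; exact: lebesgue_measure_affine.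
rewrite ge0_integral_mscale//; congr (_ * _).
by rewrite ge0_integral_pushforward.
Qed.

(** Tonelli for the product in the recursive definition of [lebesgue_rV]; it drives the inductions
    on the dimension. *)
Lemma ge0_integral_lebesgue_rVS n (h : 'rV[R]_n.+1 -> \bar R) :
  measurable_fun setT h -> (forall v, 0 <= h v) ->
  \int[lebesgue_rV]_v h v =
  \int[lebesgue_measure]_x \int[lebesgue_rV]_v h (row_cons (x, v)).
Proof.
move=> mh h0.
have mr := @measurable_row_cons R n.
transitivity (\int[@lebesgue_measure R \x @lebesgue_rV R n]_p h (row_cons p)).
  exact: (ge0_integral_pushforward mr (@lebesgue_measure R \x @lebesgue_rV R n)
    measurableT mh).
by rewrite fubini_tonelli1//; exact: measurableT_comp.
Qed.

(** Induction on the dimension: the first coordinate contributes one factor [|c|], the remaining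
    ones [|c| ^ n]. *)
Lemma ge0_integral_lebesgue_rV_affine n (c : R) (a : 'rV[R]_n)
    (h : 'rV[R]_n -> \bar R) :
  c != 0%R -> measurable_fun setT h -> (forall x, 0 <= h x) ->
  (`|c| ^+ n)%:E * \int[lebesgue_rV]_v h (c *: v + a)%R =
  \int[lebesgue_rV]_v h v.
Proof.
move=> c0; elim: n a h => [|n IHn] a h mh h0.
  rewrite expr0 mul1e; apply: eq_integral => v _; congr h.
  by rewrite [LHS]thinmx0 [RHS]thinmx0.
have mha : measurable_fun setT (fun v : 'rV[R]_n.+1 => h (c *: v + a)%R).
  by apply: measurableT_comp => //; exact: measurable_affine.
rewrite !ge0_integral_lebesgue_rVS//.
pose a0 := a ord0 ord0; pose a1 := rsubmx (a : 'rV_(1 + n)).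
have rcE (x : measurableTypeR R) (v : 'rV[R]_n) :
    (c *: row_cons (x, v) + a = row_cons (aff c a0 x, c *: v + a1))%R.
  apply/rowP => j; rewrite mxE mxE !row_consE/=.
  case: unliftP => [k ->|->]//=.
  by rewrite !mxE rshift1.
have mhr : measurable_fun setT (fun p => h (@row_cons R n p)).
  by apply: measurableT_comp => //; exact: measurable_row_cons.
pose Phi (y : measurableTypeR R) := \int[@lebesgue_rV R n]_v h (row_cons (y, v)).
have mPhi : measurable_fun setT Phi.
  exact: (measurable_fun_fubini_tonelli_F (m2 := @lebesgue_rV R n) _ mhr).
have Phi0 y : 0 <= Phi y by exact: integral_ge0.
have mrow y : measurable_fun setT (fun v : 'rV[R]_n => h (row_cons (y, v))).
  exact: (measurableT_comp mhr (measurable_pair1 y)).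
have cn0 : (`|c| ^+ n != 0)%R by rewrite expf_neq0// normr_eq0.
have inner (x : measurableTypeR R) :
    \int[lebesgue_rV]_v h (c *: row_cons (x, v) + a)%R =
    ((`|c| ^+ n)^-1)%:E * Phi (aff c a0 x).
  rewrite /Phi -(IHn a1 (fun v => h (row_cons (aff c a0 x, v))))// muleA -EFinM mulVf// mul1e.
  by apply: eq_integral => v _; rewrite rcE.
under eq_integral do rewrite inner.
rewrite ge0_integralZl//; last first.
  exact: (measurableT_comp mPhi (measurable_aff c a0)).
by rewrite -(@ge0_integral_lebesgue_affine c a0 Phi)// muleA -EFinM exprS mulfK.
Qed.

(** [S_lambda] is a composition of two partial affine maps: [x] goes to [s x + (s / lambda) y] with
    [y] fixed, then [y] goes to [x - k y] with [x] fixed. The Jacobian is [(s k) ^ n = lambda ^ -n],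
    as [2 s ^ 2 = 1]. *)
Lemma ge0_integral_scaled_rotation n (lambda : R)
    (h : 'rV[R]_n * 'rV[R]_n -> \bar R) :
  (0 < lambda)%R -> measurable_fun setT h -> (forall p, 0 <= h p) ->
  (lambda^-1 ^+ n)%:E *
    \int[lebesgue_rV \x lebesgue_rV]_p h (scaled_rotation lambda p) =
  \int[lebesgue_rV \x lebesgue_rV]_p h p.
Proof.
move=> l0 mh h0; pose s : R := ((Num.sqrt 2)^-1)%R.
have s0 : (0 < s)%R by rewrite invr_gt0 sqrtr_gt0.
have ss : (s * s = 2^-1)%R by rewrite -invfM -expr2 sqr_sqrtr.
pose k := (2 * s / lambda)%R.
have k0 : (0 < k)%R by rewrite divr_gt0// mulr_gt0.
have mhS : measurable_fun setT (fun p => h (scaled_rotation lambda p)).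
  by apply: measurableT_comp => //; exact: measurable_scaled_rotation.
(* [h1] is [h] after the second of these maps. *)
pose h1 (p : 'rV[R]_n * 'rV[R]_n) := h (p.1, - k *: p.2 + p.1)%R.
have h10 p : 0 <= h1 p by exact: h0.
have mh1 : measurable_fun setT h1.
  apply: measurableT_comp => //; apply: measurable_fun_pair => //=.
  under eq_fun do rewrite addrC -[X in (X + _)%R]scale1r.
  exact: measurable_lincomb.
transitivity ((k ^+ n)%:E * ((s ^+ n)%:E *
    \int[lebesgue_rV \x lebesgue_rV]_p h (scaled_rotation lambda p))).
  rewrite muleA -EFinM -exprMn; congr (_%:E * _); congr (_ ^+ _)%R.
  by rewrite /k mulrAC -(mulrA 2%R) ss mulfV ?mul1r.
rewrite fubini_tonelli2// -ge0_integralZl//; last 3 first.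
- exact: (measurable_fun_fubini_tonelli_G (m1 := @lebesgue_rV R n) _ mhS).
- by move=> x _; exact: integral_ge0.
- by rewrite lee_fin exprn_ge0// ltW.
transitivity ((k ^+ n)%:E *
    \int[@lebesgue_rV R n]_y \int[@lebesgue_rV R n]_x h1 (x, y)).
  congr (_ * _); apply: eq_integral => y _.
  rewrite -(ge0_integral_lebesgue_rV_affine (c := s) ((s / lambda) *: y) _
    (h := fun x => h1 (x, y))) ?gt_eqF//.
    rewrite gtr0_norm//; congr (_ * _); apply: eq_integral => x _.
    rewrite /h1/scaled_rotation/=; congr (h (_, _)).
      by rewrite scalerDr scalerA.
    rewrite scalerBr scalerA addrCA -scalerDl -/s; congr (_ + _)%R.
    by rewrite -scaleNr; congr (_ *: _); rewrite /k; ring.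
  exact: (measurableT_comp mh1 (measurable_pair2 y)).
(* The order of integration is exchanged, so that the first variable is now the fixed one. *)
rewrite -(fubini_tonelli h1 mh1 h10) -ge0_integralZl//; last 3 first.
- exact: (measurable_fun_fubini_tonelli_F (m2 := @lebesgue_rV R n) _ mh1).
- by move=> x _; exact: integral_ge0.
- by rewrite lee_fin exprn_ge0// ltW.
rewrite fubini_tonelli1//; apply: eq_integral => x _; rewrite /h1/=.
rewrite -[RHS](ge0_integral_lebesgue_rV_affine (c := - k) x
  (h := fun z => h (x, z)))//; first by rewrite normrN gtr0_norm.
- by rewrite oppr_eq0 gt_eqF.
- exact: (measurableT_comp mh (measurable_pair1 x)).
Qed.

(** Change of variables for the indicator of a null set: the Jacobian is nonzero, so the preimage is
    null. *)
Lemma ae_scaled_rotation n (lambda : R) (P : 'rV[R]_n * 'rV[R]_n -> Prop) :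
  (0 < lambda)%R -> {ae (lebesgue_rV \x lebesgue_rV), forall p, P p} ->
  {ae (lebesgue_rV \x lebesgue_rV), forall p, P (scaled_rotation lambda p)}.
Proof.
move=> l0 [M [mM M0 PM]].
have mSM : measurable (@scaled_rotation R n lambda @^-1` M).
  rewrite -[X in measurable X]setTI.
  exact: (measurable_scaled_rotation lambda measurableT mM).
exists (scaled_rotation lambda @^-1` M); split => //.
- have : (lambda^-1 ^+ n)%:E * \int[@lebesgue_rV R n \x @lebesgue_rV R n]_p
      (\1_(@scaled_rotation R n lambda @^-1` M) p)%:E =
      \int[lebesgue_rV \x lebesgue_rV]_p (\1_M p)%:E.
    rewrite -(@ge0_integral_scaled_rotation n lambda
      (fun p => (\1_M p)%:E) l0)//; first exact/measurable_EFinP.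
  rewrite !integral_indic// !setIT [X in _ = X]M0 => /eqP.
  rewrite mule_eq0 eqe expf_eq0 invr_eq0 (gt_eqF l0) andbF/= => /eqP.
  exact.
- by move=> p; exact: PM.
Qed.

End affine_change_of_variables.

(** * Gaussian integrals for an arbitrary scalar product *)

Section gaussian.
Local Open Scope ereal_scope.
Context (R : realType).

(** The unit cube has measure one, also in dimension zero. *)
Lemma lebesgue_rV_setT_gt0 n : 0 < lebesgue_rV [set: 'rV[R]_n].
Proof.
pose A (i : 'I_n) : set (measurableTypeR R) := `[0%R, 1%R]%classic.
have := @lebesgue_rV_box R n A (fun=> measurable_itv _).
rewrite big1 => [A1|i _]; last first.
  by rewrite lebesgue_measure_itv/= lte_fin ltr01 oppr0 adde0.
apply: (@lt_le_trans _ _ 1); first by rewrite lte_fin.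
rewrite -A1; apply: le_measure; rewrite ?inE//.
rewrite (_ : [set v : 'rV[R]_n | _] = \bigcap_(i in [set: 'I_n])
    ((fun v : 'rV[R]_n => v ord0 i) @^-1` A i)); last first.
  by apply/seteqP; split => v /= h i; [move=> _; exact: h|exact: (h i I)].
apply: fin_bigcap_measurable => // i _.
rewrite -[X in measurable X]setTI.
exact: (@measurable_fun_coord R 1 n ord0 i measurableT _ (measurable_itv _)).
Qed.

Lemma integral_gauss_scaled (a : R) : (0 < a)%R ->
  \int[@lebesgue_measure R]_x (expR (- a * x ^+ 2))%:E < +oo.
Proof.
move=> a0; have s0 : (0 < Num.sqrt a)%R by rewrite sqrtr_gt0.
have := @ge0_integral_lebesgue_affine R (Num.sqrt a) 0
  (fun x => (gauss_fun x)%:E) (lt0r_neq0 s0) _ _.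
rewrite integralT_gauss gtr0_norm// => /(_ _ _)E.
(* An infinite value would make the product with [sqrt a] infinite, whereas it is [sqrt pi]. *)
rewrite ltey; apply/eqP => h.
have : (Num.sqrt a)%:E *
    \int[@lebesgue_measure R]_x (expR (- a * x ^+ 2))%:E = (Num.sqrt pi)%:E.
  rewrite -E//.
  - congr (_ * _); apply: eq_integral => x _; congr (expR _)%:E.
    by rewrite addr0 exprMn sqr_sqrtr ?mulNr// ltW.
  - by apply/measurable_EFinP; exact: measurable_gauss_fun.
  - by move=> x; rewrite lee_fin gauss_fun_ge0.
by rewrite h gt0_muley// lte_fin.
Qed.

Lemma measurable_sum_sqr n :
  measurable_fun setT (fun v : 'rV[R]_n => (\sum_i v ord0 i ^+ 2)%R).
Proof.
by apply: measurable_sum => i; apply: measurable_funX; exact: measurable_fun_coord.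
Qed.

(** The integrand is a product over the coordinates, so induction splits off one one-dimensional
    Gaussian at a time. *)
Lemma integral_gauss_rV n (a : R) : (0 < a)%R ->
  \int[@lebesgue_rV R n]_v (expR (- a * \sum_i v ord0 i ^+ 2))%:E < +oo.
Proof.
move=> a0.
have mG k : measurable_fun setT
    (fun v : 'rV[R]_k => (expR (- a * \sum_i v ord0 i ^+ 2))%:E).
  apply/measurable_EFinP; apply: measurableT_comp => //.
  by apply: measurable_funM => //; exact: measurable_sum_sqr.
elim: n => [|n IHn].
  by rewrite integral_dirac// diracT mul1e ltry.
rewrite ge0_integral_lebesgue_rVS//.
pose G := \int[@lebesgue_rV R n]_v (expR (- a * \sum_i v ord0 i ^+ 2))%:E.
have G0 : 0 <= G by apply: integral_ge0 => v _; rewrite lee_fin expR_ge0.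
have mg : measurable_fun [set: measurableTypeR R]
    (fun x : R => (expR (- a * x ^+ 2))%:E).
  apply/measurable_EFinP; apply: measurableT_comp => //.
  by apply: measurable_funM => //; exact: measurable_funX.
have inner (x : measurableTypeR R) : \int[@lebesgue_rV R n]_v
    (expR (- a * \sum_i row_cons (x, v) ord0 i ^+ 2))%:E =
    G * (expR (- a * x ^+ 2))%:E.
  rewrite muleC -ge0_integralZl//; apply: eq_integral => v _.
  rewrite big_ord_recl row_consE unlift_none/= mulrDr expRD EFinM.
  by under eq_bigr do rewrite row_consE liftK/=.
under eq_integral do rewrite inner.
rewrite ge0_integralZl//.
apply: lte_mul_pinfty => //; first by rewrite ge0_fin_numE.
exact: integral_gauss_scaled.
Qed.

Lemma continuous_sum (T : topologicalType) k (F : 'I_k -> T -> R) :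
  (forall i, continuous (F i)) -> continuous (fun x => (\sum_i F i x)%R).
Proof.
by move=> cF; apply: continuous_big => //; exact: add_continuous.
Qed.

Lemma continuous_mul (T : topologicalType) (f g : T -> R) :
  continuous f -> continuous g -> continuous (fun x => (f x * g x)%R).
Proof. by move=> cf cg x; apply: cvgM; [exact: cf|exact: cg]. Qed.

Variables (n : nat) (dot : {dot 'rV[R]_n for @idfun R}).

Lemma dotZZ (c : R) (z : 'rV[R]_n) : (dot (c *: z) (c *: z) = c ^+ 2 * dot z z)%R.
Proof. by rewrite linearZl_LR linearZr_LR/= mulrA expr2. Qed.

Lemma dot_ge0 (z : 'rV[R]_n) : (0 <= dot z z)%R.
Proof.
have [->|z0] := eqVneq z 0%R; last exact/ltW/neq0_dnorm_gt0.
by rewrite linear0r.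
Qed.

Lemma dot_norm_sqr (z : 'rV[R]_n) : (dot_norm dot z ^+ 2 = dot z z)%R.
Proof. by rewrite sqr_sqrtr// dot_ge0. Qed.

Lemma continuous_dot : continuous (fun z : 'rV[R]_n => dot z z).
Proof.
under eq_fun do rewrite dotE.
apply: continuous_sum => i; apply: continuous_sum => j.
apply: continuous_mul; first exact: coord_continuous.
by apply: continuous_mul; [exact: coord_continuous|exact: cst_continuous].
Qed.

(** The quadratic form attains a positive minimum on the compact Euclidean unit sphere, and
    homogeneity extends the bound to all vectors. *)
Lemma dot_coercive :
  exists2 c, (0 < c)%R & forall z : 'rV[R]_n, (c * \sum_i z ord0 i ^+ 2 <= dot z z)%R.
Proof.
pose q (z : 'rV[R]_n) : R := (\sum_i z ord0 i ^+ 2)%R.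
have q0 z : (0 <= q z)%R by apply: sumr_ge0 => i _; exact: sqr_ge0.
have qZ (c : R) z : (q (c *: z) = c ^+ 2 * q z)%R.
  by rewrite /q mulr_sumr; apply: eq_bigr => i _; rewrite mxE exprMn.
have cq : continuous q.
  apply: continuous_sum => i.
  by apply: continuous_mul; exact: coord_continuous.
pose S := [set z : 'rV[R]_n | q z = 1%R].
have cS : compact S.
  apply: (@subclosed_compact _ S
    [set v : 'rV[R]_n | forall i, v ord0 i \in `[-1, 1]%R]).
  - have -> : S = q @^-1` [set 1%R] by [].
    by apply: closed_comp => [z _|]; [exact: cq|exact: closed_eq].
  - apply: (@rV_compact R n (fun=> [set` `[-1, 1]%R])) => i.
    exact: segment_compact.
  - move=> v /= qv i; rewrite in_itv/= -ler_norml.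
    rewrite -(@ler_pXn2r _ 2)// ?nnegrE// expr1n real_normK ?num_real// -qv.
    rewrite /q (bigD1 i)//= lerDl; apply: sumr_ge0 => j _; exact: sqr_ge0.
have [c c0 cP] : exists2 c, (0 < c)%R & forall z, S z -> (c <= dot z z)%R.
  (* The sphere is empty only in dimension zero, where any positive constant serves. *)
  have [[z0 Sz0]|S0] := pselect (S !=set0); last first.
    by exists 1%R => // z Sz; exfalso; apply: S0; exists z.
  have [||z /set_mem Sz zP] := @EVT_min_rV R n (fun z => dot z z) S _ cS.
  - by exists z0.
  - by apply: continuous_subspaceT; exact: continuous_dot.
  exists (dot z z) => [|z' Sz']; last by apply: zP; rewrite inE.
  apply: neq0_dnorm_gt0; apply/eqP => z00; move: Sz; rewrite /S/= z00.
  rewrite /q big1 => [/esym/eqP|i _]; first by rewrite oner_eq0.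
  by rewrite mxE expr0n.
exists c => // z; rewrite -/(q z).
have := q0 z; rewrite le_eqVlt => /predU1P[<-|qz0].
  by rewrite mulr0 dot_ge0.
have s0 : (0 < Num.sqrt (q z))%R by rewrite sqrtr_gt0.
have := cP ((Num.sqrt (q z))^-1 *: z)%R; rewrite /S/= qZ dotZZ exprVn.
by rewrite sqr_sqrtr// mulVf ?gt_eqF// => /(_ erefl); rewrite mulrC ler_pdivlMr.
Qed.

Lemma measurable_gauss (beta : R) :
  measurable_fun setT (fun z => (expR (- beta * dot_norm dot z ^+ 2))%:E).
Proof.
apply/measurable_EFinP; apply: measurableT_comp => //.
apply: measurable_funM => //; under eq_fun do rewrite dot_norm_sqr dotE.
apply: measurable_sum => i; apply: measurable_sum => j.
apply: measurable_funM; first exact: measurable_fun_coord.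
by apply: measurable_funM => //; exact: measurable_fun_coord.
Qed.

(** Coercivity places a Euclidean Gaussian above the integrand. *)
Lemma integral_gauss_lty (beta : R) : (0 < beta)%R ->
  \int[lebesgue_rV]_z (expR (- beta * dot_norm dot z ^+ 2))%:E < +oo.
Proof.
move=> b0; have [c c0 cP] := dot_coercive.
apply: le_lt_trans (integral_gauss_rV n (mulr_gt0 b0 c0)).
apply: ge0_le_integral => //.
- exact: measurable_gauss.
- apply/measurable_EFinP; apply: measurableT_comp => //.
  by apply: measurable_funM => //; exact: measurable_sum_sqr.
- move=> z _; rewrite lee_fin ler_expR dot_norm_sqr !mulNr lerN2 -mulrA.
  by rewrite ler_pM2l.
Qed.

(** [gauss_mass] is the [fine] part of an extended integral; finiteness excludes the default value 0
    at infinity. *)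
Lemma gauss_massE (beta : R) : (0 < beta)%R -> (gauss_mass dot beta)%:E =
  \int[lebesgue_rV]_z (expR (- beta * dot_norm dot z ^+ 2))%:E.
Proof.
move=> b0; rewrite /gauss_mass /Rintegral fineK// ge0_fin_numE.
  exact: integral_gauss_lty.
by apply: integral_ge0 => z _; rewrite lee_fin expR_ge0.
Qed.

(** If the mass vanished, the exponential would be zero almost everywhere on a space of positive
    measure. *)
Lemma gauss_mass_gt0 (beta : R) : (0 < beta)%R -> (0 < gauss_mass dot beta)%R.
Proof.
move=> b0; rewrite -lte_fin gauss_massE// lt0e.
rewrite integral_ge0 ?andbT => [|z _]; last by rewrite lee_fin expR_ge0.
apply/eqP => h.
have : ae_eq lebesgue_rV setT
    (fun z => (expR (- beta * dot_norm dot z ^+ 2))%:E) (cst 0).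
  apply/ae_eq_integral_abs => //; first exact: measurable_gauss.
  rewrite -[RHS]h; apply: eq_integral => z _.
  by rewrite gee0_abs// lee_fin expR_ge0.
move=> [M [mM M0 hM]]; have := lebesgue_rV_setT_gt0 n.
rewrite (_ : setT = M) ?M0 ?ltxx//; apply/esym; rewrite -subTset => z _.
by apply: hM => /= /(_ I)/eqP; rewrite eqe expR_eq0.
Qed.

(** Substitution of [lambda z] for [z]. The factor equals the Jacobian of [S_lambda], so that the
    two cancel in the thermalized weight. *)
Lemma gauss_mass_scale (lambda beta : R) : (0 < lambda)%R -> (0 < beta)%R ->
  (gauss_mass dot (lambda ^+ 2 * beta) = lambda^-1 ^+ n * gauss_mass dot beta)%R.
Proof.
move=> l0 b0; apply: EFin_inj.
rewrite EFinM !gauss_massE// ?mulr_gt0 ?exprn_gt0//.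
rewrite -(@ge0_integral_lebesgue_rV_affine R n lambda 0
  (fun z => (expR (- beta * dot_norm dot z ^+ 2))%:E)) ?gt_eqF//.
- rewrite muleA -EFinM gtr0_norm// -exprMn mulVf ?gt_eqF// expr1n mul1e.
  apply: eq_integral => z _; congr (expR _)%:E.
  by rewrite addr0 !dot_norm_sqr dotZZ; ring.
- exact: measurable_gauss.
Qed.

End gaussian.

(** * Almost everywhere statements on products and under dilations *)

Section product_ae.
Local Open Scope ereal_scope.
Context d1 d2 (T1 : measurableType d1) (T2 : measurableType d2) (R : realType).
Variables (m1 : {sigma_finite_measure set T1 -> \bar R})
          (m2 : {sigma_finite_measure set T2 -> \bar R}).

Lemma ae_product_fst (P : T1 -> Prop) : {ae m1, forall x, P x} ->
  {ae (m1 \x m2), forall p, P p.1}.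
Proof.
move=> [M [mM M0 PM]]; exists (M `*` setT); split.
- exact: measurableX.
- apply: etrans (product_measure1E m1 m2 mM measurableT) _.
  by rewrite [X in X * _]M0 mul0e.
- by move=> [x y] /= Px; split => //; exact: PM.
Qed.

(** By Tonelli almost every section of a null set is null; since [m2] does not vanish, at least one
    such [y] exists. *)
Lemma ae_section (P : T1 * T2 -> Prop) : 0 < m2 setT ->
  {ae (m1 \x m2), forall p, P p} -> exists y, {ae m1, forall x, P (x, y)}.
Proof.
move=> m2T [M [mM M0 PM]].
have m1M : measurable_fun setT (fun p => (\1_M p : R)%:E).
  exact/measurable_EFinP.
have m1M0 p : 0 <= (\1_M p : R)%:E by rewrite lee_fin.
pose F y := \int[m1]_x (\1_M (x, y))%:E.
have : \int[m2]_y F y = 0.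
  have := fubini_tonelli2 (m1 := m1) (m2 := m2) _ m1M
    m1M0.
  by rewrite integral_indic// setIT [X in X = _]M0 => /esym.
have F0 y : 0 <= F y by exact: integral_ge0.
have mF : measurable_fun setT F.
  exact: (measurable_fun_fubini_tonelli_G (m1 := m1) _ m1M).
move=> IF0.
have [K [mK K0 FK]] : ae_eq m2 setT F (cst 0).
  apply/ae_eq_integral_abs => //.
  by rewrite -[RHS]IF0; apply: eq_integral => y _; rewrite gee0_abs.
have [y Ky] : exists y, ~ K y.
  apply: contrapT => /forallNP h; move: m2T.
  rewrite (_ : setT = K) ?K0 ?ltxx//; apply/esym; rewrite -subTset => y _.
  exact: contrapT (h y).
have Fy : F y = 0 by apply: contrapT => h; apply: Ky; apply: FK => /(_ I).
have mMy : measurable [set x | M (x, y)].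
  by rewrite -[X in measurable X]setTI; exact: (measurable_pair2 y measurableT mM).
exists y, [set x | M (x, y)]; split => //; last by move=> x Px; exact: PM.
rewrite -Fy -[LHS](_ : \int[m1]_x (\1_[set x | M (x, y)] x)%:E = _).
  by apply: eq_integral => x _; rewrite !indicE.
by rewrite integral_indic// setIT.
Qed.

(** Freezing one good [y] turns [F] into an almost everywhere limit of measurable functions of [x].
    This provides the Borel version of [Lhat]. *)
Lemma ae_fst_limit (u : nat -> T1 * T2 -> R) (F : T1 -> R) :
  (forall k, measurable_fun setT (u k)) -> (forall k p, (0 <= u k p)%R) ->
  0 < m2 setT ->
  {ae (m1 \x m2), forall p, u k p @[k --> \oo] --> F p.1} ->
  exists G : T1 -> R, [/\ measurable_fun setT G, forall x, (0 <= G x)%R &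
    {ae m1, forall x, F x = G x}].
Proof.
move=> mu u0 m2T /(ae_section m2T)[y uF].
(* The upper limit exists everywhere and is measurable, whereas the limit is known to exist only
   almost everywhere. *)
pose G x := fine (limn_esup (fun k => (u k (x, y))%:E)).
have mG : measurable_fun setT G.
  apply: measurableT_comp => //; apply: measurable_fun_limn_esup => k.
  by apply/measurable_EFinP; exact: (measurableT_comp (mu k) (measurable_pair2 y)).
(* Truncation at 0 secures the sign everywhere and leaves limits of the nonnegative [u k]
   unchanged. *)
exists (fun x => Num.max (G x) 0%R); split.
- exact: measurable_maxr.
- by move=> x; rewrite le_max lexx orbT.
apply: filterS uF => x uF.
have euF : (u k (x, y))%:E @[k --> \oo] --> (F x)%:E.
  by apply: cvg_EFin; [exact: nearW|exact: uF].
have -> : G x = F x.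
  by rewrite /G is_cvg_limn_esupE ?(cvg_lim _ euF)//; apply/cvg_ex; eexists; exact: euF.
by apply/esym/max_idPl; apply: (cvgr_to_ge uF); exact: nearW.
Qed.

End product_ae.

Lemma ae_lebesgue_rV_scale (R : realType) n (c : R) (P : 'rV[R]_n -> Prop) :
  c != 0 -> {ae lebesgue_rV, forall v, P v} ->
  {ae lebesgue_rV, forall v, P (c *: v)}.
Proof.
move=> c0 [M [mM M0 PM]].
have msc : measurable_fun setT (fun v : 'rV[R]_n => c *: v).
  by have := @measurable_affine R n c 0; under eq_fun do rewrite addr0.
have mSM : measurable ((fun v : 'rV[R]_n => c *: v) @^-1` M).
  by rewrite -[X in measurable X]setTI; exact: (msc measurableT _ mM).
exists ((fun v : 'rV[R]_n => c *: v) @^-1` M); split => //.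
- have : ((`|c| ^+ n)%:E * \int[@lebesgue_rV R n]_v
      (\1_((fun v : 'rV[R]_n => (c *: v)%R) @^-1` M) v)%:E =
      \int[lebesgue_rV]_v (\1_M v)%:E)%E.
    rewrite -(@ge0_integral_lebesgue_rV_affine R n c 0
      (fun v => (\1_M v)%:E) c0)//; last exact/measurable_EFinP.
    congr (_ * _)%E; apply: eq_integral => v _.
    by rewrite addr0 !indicE.
  rewrite !integral_indic// !setIT [X in _ = X]M0 => /eqP.
  by rewrite mule_eq0 eqe expf_eq0 normr_eq0 (negbTE c0) andbF/= => /eqP.
- by move=> p; exact: PM.
Qed.

(** * Thermalized measures in rotated coordinates and their limit *)

Section thermalization.
Local Open Scope ereal_scope.
Context (R : realType) (n : nat) (dot : {dot 'rV[R]_n for @idfun R}).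
Local Notation T := ('rV[R]_n * 'rV[R]_n)%type.
Local Notation leb2 := (@lebesgue_rV R n \x @lebesgue_rV R n).
Local Notation s := ((Num.sqrt 2)^-1 : R)%R.

Let s_gt0 : (0 < s)%R.
Proof. by rewrite invr_gt0 sqrtr_gt0. Qed.

Lemma gauss_weight_bar_ge0 (beta : R) eta :
  (0 <= gauss_weight_bar dot beta eta)%R.
Proof.
rewrite mulr_ge0 ?expR_ge0// invr_ge0.
by apply: Rintegral_ge0 => x _; exact: expR_ge0.
Qed.

Lemma measurable_gauss_weight_bar (beta : R) :
  measurable_fun setT (gauss_weight_bar dot beta).
Proof.
apply: measurable_funM => //; apply/measurable_EFinP.
exact: measurable_gauss.
Qed.

(** The factor 2 in the exponent is a dilation by [sqrt 2], so the integral is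
    [B_(2 beta) / B_beta], which is [2 ^ -N] when [n = 2 N]. *)
Lemma integral_gauss_weight_bar (beta : R) : (0 < beta)%R ->
  \int[lebesgue_rV]_eta (gauss_weight_bar dot beta eta)%:E = (s ^+ n)%:E.
Proof.
move=> b0; have B0 := gauss_mass_gt0 dot b0.
under eq_integral do rewrite EFinM.
rewrite ge0_integralZl//; last 2 first.
- exact: measurable_gauss.
- by rewrite lee_fin invr_ge0 ltW.
rewrite -gauss_massE ?mulr_gt0// -EFinM; congr EFin.
have -> : (2 * beta = Num.sqrt 2 ^+ 2 * beta :> R)%R by rewrite sqr_sqrtr.
rewrite gauss_mass_scale ?sqrtr_gt0// mulrCA mulVf ?mulr1// gt_eqF//.
Qed.

(** The components of [S_lambda] differ by [(2 s / lambda) eta], so [lambda ^ 2 beta] times the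
    squared norm of the difference is [2 beta] times that of [eta]; the prefactor cancels against
    [gauss_mass]. *)
Lemma gauss_weight_scaled_rotation (lambda beta : R) (p : T) :
  (0 < lambda)%R -> (0 < beta)%R ->
  (lambda^-1 ^+ n *
    gauss_weight dot (lambda ^+ 2 * beta) (scaled_rotation lambda p) =
    gauss_weight_bar dot beta p.2)%R.
Proof.
move=> l0 b0; have B0 := gauss_mass_gt0 dot b0.
have l'0 : (lambda^-1 ^+ n != 0)%R by rewrite expf_neq0// invr_eq0 gt_eqF.
rewrite /gauss_weight /gauss_weight_bar gauss_mass_scale//.
rewrite mulrA invfM mulrA mulfV// mul1r; congr (_ * expR _)%R.
have -> : ((scaled_rotation lambda p).1 - (scaled_rotation lambda p).2 =
    (2 * s / lambda) *: p.2)%R.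
  rewrite /= -scalerBr opprD addrACA subrr add0r opprK -mulr2n.
  by rewrite -(scaler_nat 2 (lambda^-1 *: p.2)%R) !scalerA; congr (_ *: _)%R; ring.
rewrite !dot_norm_sqr dotZZ.
have ss : (s ^+ 2 = 2^-1)%R by rewrite exprVn sqr_sqrtr.
rewrite expr_div_n exprMn ss.
by field; rewrite gt_eqF.
Qed.

Lemma continuous_measurable_prod (f : T -> R) :
  continuous f -> measurable_fun setT f.
Proof.
move=> cf; apply: (measurability _ (RGenOpens.measurableE R)).
move=> _ [_ [x [y ->]] <-]; rewrite setTI.
apply: open_measurable_prod; apply: open_comp; last exact: interval_open.
by move=> p _; exact: cf.
Qed.

Lemma cvg_scaled_rotation (l : nat -> R) (p : T) :
  (forall k, 0 < l k)%R -> l k @[k --> \oo] --> +oo%R ->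
  scaled_rotation (l k) p @[k --> \oo] --> (s *: p.1, s *: p.1)%R.
Proof.
move=> l0 ly.
have lV : ((l k)^-1 @[k --> \oo] --> 0)%R.
  by apply/gtr0_cvgV0 => //; exact: nearW.
have cfst : (s *: (p.1 + (l k)^-1 *: p.2) @[k --> \oo] --> s *: p.1)%R.
  have -> : (s *: p.1 = s *: (p.1 + 0 *: p.2))%R by rewrite scale0r addr0.
  apply: cvgZ; first exact: cvg_cst.
  apply: cvgD; first exact: cvg_cst.
  by apply: cvgZ => //; exact: cvg_cst.
have csnd : (s *: (p.1 - (l k)^-1 *: p.2) @[k --> \oo] --> s *: p.1)%R.
  have -> : (s *: p.1 = s *: (p.1 - 0 *: p.2))%R by rewrite scale0r subr0.
  apply: cvgZ; first exact: cvg_cst.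
  apply: cvgB; first exact: cvg_cst.
  by apply: cvgZ => //; exact: cvg_cst.
exact: (cvg_pair cfst csnd).
Qed.

Variables (mu : {measure set T -> \bar R}) (L' : T -> R).
Hypotheses (mL' : measurable_fun setT L') (L'0 : forall p, (0 <= L' p)%R).
Hypothesis muE : forall A, measurable A -> mu A = \int[leb2]_(p in A) (L' p)%:E.
Variables (beta0 : R) (beta0_gt0 : (0 < beta0)%R).

(** The left-hand side of the equi-integrability bound, with the Borel density [L']. *)
Let rotated (lambda : R) (p : T) : R :=
  (gauss_weight_bar dot beta0 p.2 * L' (scaled_rotation lambda p))%R.

Let measurable_rotated lambda : measurable_fun setT (rotated lambda).
Proof.
apply: measurable_funM.
- by apply: measurableT_comp => //; exact: measurable_gauss_weight_bar.
- by apply: measurableT_comp => //; exact: measurable_scaled_rotation.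
Qed.

Let rotated_ge0 lambda p : (0 <= rotated lambda p)%R.
Proof. by rewrite mulr_ge0// gauss_weight_bar_ge0. Qed.

(** The weight and [L'] act as successive densities; after the rotation the Jacobian is absorbed by
    the weight. *)
Lemma ge0_integral_thermalized (lambda : R) (h : T -> \bar R) :
  (0 < lambda)%R -> measurable_fun setT h -> (forall p, 0 <= h p) ->
  \int[thermalized dot mu (lambda ^+ 2 * beta0)]_p h p =
  \int[leb2]_p (h (scaled_rotation lambda p) * (rotated lambda p)%:E).
Proof.
move=> l0 mh h0; set b := (lambda ^+ 2 * beta0)%R.
have mw := measurable_gauss_weight dot b.
have w0 := gauss_weight_ge0 dot b.
have mL : measurable_fun setT (fun p => (L' p)%:E) by exact/measurable_EFinP.
have L0 p : 0 <= (L' p)%:E by rewrite lee_fin.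
rewrite (ge0_integral_density mu mw w0 mh h0).
have mhw : measurable_fun setT (fun p => h p * (gauss_weight dot b p)%:E).
  by apply: emeasurable_funM; [exact: mh|exact: mw].
have hw0 p : 0 <= h p * (gauss_weight dot b p)%:E by rewrite mule_ge0.
rewrite (eq_measure_integral (density leb2 mL L0)); last first.
  by move=> A mA _; exact: muE.
rewrite (ge0_integral_density leb2 mL L0 mhw hw0).
have mk : measurable_fun setT
    (fun p => h p * (gauss_weight dot b p)%:E * (L' p)%:E).
  by apply: emeasurable_funM; [exact: mhw|exact: mL].
have k0 p : 0 <= h p * (gauss_weight dot b p)%:E * (L' p)%:E by rewrite mule_ge0.
rewrite -(ge0_integral_scaled_rotation l0 mk k0) -ge0_integralZl//; last 2 first.
- exact: (measurableT_comp mk (@measurable_scaled_rotation R n lambda)).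
- by rewrite lee_fin exprn_ge0// invr_ge0 ltW.
apply: eq_integral => p _.
by rewrite /rotated -(gauss_weight_scaled_rotation p l0 beta0_gt0) !EFinM -!muleA
  [LHS]muleCA.
Qed.

Variable g : T -> R.
Hypothesis ig : leb2.-integrable setT (EFin \o g).
Variables (lambda0 : R) (lambda0_gt0 : (0 < lambda0)%R).
Hypothesis L'g : forall lambda, (lambda0 <= lambda)%R ->
  {ae leb2, forall p, (rotated lambda p <= g p)%R}.

(** Parametrizes large [beta] as [lambda ^ 2 beta0]; the threshold corresponds to
    [lambda = lambda0]. *)
Let sqrt_ratio (beta : R) : (lambda0 ^+ 2 * beta0 <= beta)%R ->
  [/\ (lambda0 <= Num.sqrt (beta / beta0))%R &
      (Num.sqrt (beta / beta0) ^+ 2 * beta0 = beta)%R].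
Proof.
move=> bl; have b0 : (0 < beta)%R.
  by apply: lt_le_trans bl; rewrite mulr_gt0// exprn_gt0.
have r0 : (0 <= beta / beta0)%R by rewrite divr_ge0// ltW.
rewrite (sqr_sqrtr r0); split; last by rewrite divfK// gt_eqF.
rewrite -(@ler_pXn2r _ 2) ?nnegrE ?sqrtr_ge0 ?(ltW lambda0_gt0)//.
by rewrite (sqr_sqrtr r0) ler_pdivlMr.
Qed.

(** The total mass is the integral of [rotated l], which is at most that of [|g|]. *)
Lemma finite_radon_thermalized (beta : R) :
  (lambda0 ^+ 2 * beta0 <= beta)%R -> finite_radon (thermalized dot mu beta).
Proof.
move=> /sqrt_ratio; set l := Num.sqrt _ => -[l0l lE].
apply: finite_measure_radon.
have l0 : (0 < l)%R by exact: lt_le_trans l0l.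
have -> : thermalized dot mu beta setT =
    \int[thermalized dot mu (l ^+ 2 * beta0)]_p (cst 1 p).
  by rewrite lE integral_cst// mul1e.
rewrite ge0_integral_thermalized//.
have /integrableP[mg gfin] := ig.
apply: le_lt_trans gfin; apply: ae_ge0_le_integral => //.
- by move=> p _; rewrite mul1e lee_fin.
- by under eq_fun do rewrite mul1e; exact/measurable_EFinP.
- exact: measurableT_comp.
- apply: filterS (L'g l0l) => p rg _.
  by rewrite /= mul1e lee_fin (le_trans rg)// ler_norm.
Qed.

Variable G : 'rV[R]_n -> R.
Hypotheses (mG : measurable_fun setT G) (G0 : forall xi, (0 <= G xi)%R).
(** Sequences suffice for dominated convergence, and each may have its own null set. *)
Hypothesis L'G : forall l : nat -> R,
  (forall k, 0 < l k)%R -> l k @[k --> \oo] --> +oo%R ->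
  {ae leb2, forall p, L' (scaled_rotation (l k) p) @[k --> \oo] --> G p.1}.

(** [G xi] stands for [Lhat (xi / sqrt 2)], so [H] is a Borel version of [Lhat]. *)
Let H (xi : 'rV[R]_n) : R := G (Num.sqrt 2 *: xi)%R.

Let mscale_rV (c : R) : measurable_fun setT (fun v : 'rV[R]_n => c *: v)%R.
Proof. by have := @measurable_affine R n c 0; under eq_fun do rewrite addr0. Qed.

Let mH : measurable_fun setT (fun xi => (H xi)%:E).
Proof. by apply/measurable_EFinP; exact: (measurableT_comp mG (mscale_rV _)). Qed.

Let H0 xi : 0 <= (H xi)%:E.
Proof. by rewrite lee_fin; exact: G0. Qed.

Let diag (xi : 'rV[R]_n) : T := (xi, xi).

Let mdiag : measurable_fun setT diag.
Proof. exact: measurable_fun_pair. Qed.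

Definition diagonal_limit : {measure set T -> \bar R} :=
  image_measure (density lebesgue_rV mH H0) mdiag.

Lemma ge0_integral_diagonal_limit (h : T -> \bar R) :
  measurable_fun setT h -> (forall p, 0 <= h p) ->
  \int[diagonal_limit]_p h p = \int[lebesgue_rV]_xi (h (xi, xi) * (H xi)%:E).
Proof.
move=> mh h0.
transitivity (\int[density lebesgue_rV mH H0]_xi h (diag xi)).
  exact: (ge0_integral_pushforward mdiag (density lebesgue_rV mH H0)
    measurableT mh).
by rewrite ge0_integral_density//; exact: measurableT_comp.
Qed.

Let limit_density (p : T) : R := (gauss_weight_bar dot beta0 p.2 * G p.1)%R.

(** Tonelli separates [eta]; its integral [s ^ n] is exactly the Jacobian of the dilation by [s],
    which turns [G] into [H]. *)
Let limit_densityE (h : T -> \bar R) :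
  measurable_fun setT h -> (forall p, 0 <= h p) ->
  \int[leb2]_p (h (s *: p.1, s *: p.1)%R * (limit_density p)%:E) =
  \int[diagonal_limit]_p h p.
Proof.
move=> mh h0; rewrite ge0_integral_diagonal_limit//.
have mk : measurable_fun setT
    (fun xi : 'rV[R]_n => h (s *: xi, s *: xi)%R * (G xi)%:E).
  apply: emeasurable_funM; last exact/measurable_EFinP.
  exact: (measurableT_comp mh (measurableT_comp mdiag (mscale_rV s))).
have k0 (xi : 'rV[R]_n) : 0 <= h (s *: xi, s *: xi)%R * (G xi)%:E.
  by rewrite mule_ge0// lee_fin.
have mw := measurable_gauss_weight_bar beta0.
have mw2 : measurable_fun setT
    (fun p : T => (gauss_weight_bar dot beta0 p.2)%:E).
  by apply/measurable_EFinP; exact: measurableT_comp.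
transitivity (\int[leb2]_p
    (h (s *: p.1, s *: p.1)%R * (G p.1)%:E *
      (gauss_weight_bar dot beta0 p.2)%:E)).
  by apply: eq_integral => p _; rewrite -muleA -EFinM [X in _ = _ * X%:E]mulrC.
rewrite fubini_tonelli1//=; last 2 first.
- by apply: emeasurable_funM => //; exact: (measurableT_comp mk measurable_fst).
- by move=> p; rewrite mule_ge0// lee_fin gauss_weight_bar_ge0.
transitivity ((s ^+ n)%:E *
    \int[lebesgue_rV]_xi (h (s *: xi, s *: xi)%R * (G xi)%:E)).
  rewrite -ge0_integralZl//.
  apply: eq_integral => xi _; rewrite /fubini_F/= ge0_integralZl//.
  - by rewrite integral_gauss_weight_bar// muleC.
  - exact/measurable_EFinP.
  - by move=> eta _; rewrite lee_fin gauss_weight_bar_ge0.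
rewrite -[RHS](@ge0_integral_lebesgue_rV_affine R n s 0) ?gt_eqF//.
- rewrite gtr0_norm//; congr (_ * _); apply: eq_integral => xi _.
  by rewrite addr0 /H scalerA mulfV ?scale1r.
- by apply: emeasurable_funM => //; exact: (measurableT_comp mh mdiag).
- by move=> xi; rewrite mule_ge0.
Qed.

(** * Nonnegative test functions *)

Section nonnegative_test.
Variables (h : T -> R) (M : R).
Hypotheses (ch : continuous h) (h0 : forall p, (0 <= h p)%R).
Hypothesis hM : forall p, (h p <= M)%R.

Let M0 : (0 <= M)%R.
Proof. by apply: le_trans (hM 0%R); exact: h0. Qed.

Let mh : measurable_fun setT h.
Proof. exact: continuous_measurable_prod. Qed.

(** Dominated convergence in rotated coordinates, with majorant [M g]; integrability of the limit
    function also gives the finiteness. *)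
Let dominated (l : nat -> R) :
  (forall k, lambda0 <= l k)%R -> l k @[k --> \oo] --> +oo%R ->
  \int[diagonal_limit]_p (h p)%:E < +oo /\
  \int[thermalized dot mu (l k ^+ 2 * beta0)]_p (h p)%:E @[k --> \oo] -->
    \int[diagonal_limit]_p (h p)%:E.
Proof.
move=> ll ly; have l0 k : (0 < l k)%R by exact: lt_le_trans (ll k).
have mEh : measurable_fun setT (EFin \o h) by exact/measurable_EFinP.
have Eh0 p : 0 <= (EFin \o h) p by rewrite lee_fin.
pose F k p := (h (scaled_rotation (l k) p) * rotated (l k) p)%:E.
pose Finf p := (h (s *: p.1, s *: p.1) * limit_density p)%:E.
have mF k : measurable_fun setT (F k).
  apply/measurable_EFinP; apply: measurable_funM => //.
  by apply: measurableT_comp => //; exact: measurable_scaled_rotation.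
have mFinf : measurable_fun setT Finf.
  apply/measurable_EFinP; apply: measurable_funM.
    exact: (measurableT_comp mh (measurableT_comp mdiag
      (measurableT_comp (mscale_rV s) measurable_fst))).
  apply: measurable_funM; last exact: measurableT_comp.
  by apply: measurableT_comp => //; exact: measurable_gauss_weight_bar.
have FE k : \int[thermalized dot mu (l k ^+ 2 * beta0)]_p (h p)%:E =
    \int[leb2]_p F k p.
  by rewrite (ge0_integral_thermalized (l0 k) mEh Eh0).
have FinfE : \int[diagonal_limit]_p (h p)%:E = \int[leb2]_p Finf p.
  by rewrite -(limit_densityE mEh Eh0).
have iMg : leb2.-integrable setT (fun p => M%:E * (EFin \o g) p).
  exact: integrableZl.
have cF : {ae leb2, forall p, setT p -> F k p @[k --> \oo] --> Finf p}.
  apply: filterS (L'G l0 ly) => p Lp _.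
  have hp : h (scaled_rotation (l k) p) @[k --> \oo] --> h (s *: p.1, s *: p.1)%R.
    exact: (cvg_comp _ h (cvg_scaled_rotation (p := p) l0 ly) (@ch _)).
  have rp : rotated (l k) p @[k --> \oo] --> limit_density p.
    by apply: cvgM => //; exact: cvg_cst.
  by apply: cvg_EFin; [exact: nearW|exact: cvgM hp rp].
(* The null set in [L'g] depends on [lambda]; along a sequence only countably many occur, and their
   union is null. *)
have dF : {ae leb2, forall p k, setT p -> `|F k p| <= M%:E * (EFin \o g) p}.
  apply: filterS (ae_foralln (fun k => L'g (ll k))) => p rg k _.
  rewrite gee0_abs; last by rewrite lee_fin mulr_ge0.
  by rewrite -EFinM lee_fin ler_pM.
have [iF _ cvF] := dominated_convergence measurableT mF mFinf cF iMg dF.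
split.
  have /integrableP[_] := iF; rewrite FinfE.
  apply: le_lt_trans; apply: ge0_le_integral => //.
  - by move=> p _; rewrite lee_fin mulr_ge0//;
      exact: mulr_ge0 (gauss_weight_bar_ge0 _ _) (G0 _).
  - exact: measurableT_comp.
  - by move=> p _; exact: lee_abs.
by rewrite FinfE; under eq_fun do rewrite FE.
Qed.

Lemma integral_diagonal_limit_lty : \int[diagonal_limit]_p (h p)%:E < +oo.
Proof.
(* Any sequence tending to [+oo] within [lambda >= lambda0] serves here. *)
have lk k : (lambda0 <= lambda0 + k%:R)%R by rewrite lerDl.
have [//|] := dominated lk.
apply/cvgryPge => A; near=> k; rewrite -lerBlDl.
by near: k; exact: nbhs_infty_ger.
Unshelve. all: by end_near. Qed.

(** Convergence at [+oo] is checked along sequences, which keeps the exceptional sets countable in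
    number. *)
Lemma cvg_thermalized_ge0 :
  \int[thermalized dot mu beta]_p (h p)%:E @[beta --> +oo%R] -->
    \int[diagonal_limit]_p (h p)%:E.
Proof.
apply/cvge_pinftyP => u uy.
(* Raising the terms to the threshold makes the majorant valid for every [k] and changes only
   finitely many terms. *)
pose v k := Num.max (u k) (lambda0 ^+ 2 * beta0)%R.
pose l k := Num.sqrt (v k / beta0)%R.
have vl k : (lambda0 ^+ 2 * beta0 <= v k)%R by rewrite le_max lexx orbT.
have [ll lE] : (forall k, lambda0 <= l k)%R /\
    (forall k, l k ^+ 2 * beta0 = v k)%R.
  by split=> k; have [] := sqrt_ratio (vl k).
have ly : l k @[k --> \oo] --> +oo%R.
  apply/cvgryPge => A; near=> k.
  rewrite (le_trans (ler_norm _))// -sqrtr_sqr ler_wsqrtr//.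
  rewrite ler_pdivlMr// le_max; apply/orP; left.
  by near: k; exact: cvgry_ge.
have [_] := dominated ll ly.
apply: cvg_trans; apply: near_eq_cvg; near=> k.
rewrite lE /v; congr (\int[thermalized dot mu _]_p _).
apply/max_idPl; near: k; exact: cvgry_ge.
Unshelve. all: by end_near. Qed.

End nonnegative_test.

(** The constant test function 1 gives the total mass. *)
Lemma finite_radon_diagonal_limit : finite_radon diagonal_limit.
Proof.
apply: finite_measure_radon.
rewrite -[X in X < _]mul1e -integral_cst//.
apply: (@integral_diagonal_limit_lty (cst 1%R) 1%R) => //.
exact: cst_continuous.
Qed.

(** * Signed test functions, through positive and negative parts *)

Section test_function.
Variable f : T -> R.
Hypothesis bcf : bounded_continuous f.

Let fpos p := Num.max (f p) 0%R.
Let fneg p := Num.max (- f p)%R 0%R.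

Let EfposE : (fun p => (f p)%:E)^\+ = (fun p => (fpos p)%:E).
Proof. by apply/funext => p; rewrite funeposE -EFin_max. Qed.

Let EfnegE : (fun p => (f p)%:E)^\- = (fun p => (fneg p)%:E).
Proof. by apply/funext => p; rewrite funenegE -EFinN -EFin_max. Qed.

Let fpos_ge0 p : (0 <= fpos p)%R. Proof. by rewrite le_max lexx orbT. Qed.

Let fneg_ge0 p : (0 <= fneg p)%R. Proof. by rewrite le_max lexx orbT. Qed.

Let continuous_max0 (k : T -> R) :
  continuous k -> continuous (fun p => Num.max (k p) 0%R).
Proof.
by move=> ck p; apply: (@continuous_max R T k (cst 0%R)); [exact: ck|exact: cst_continuous].
Qed.

Let cfpos : continuous fpos.
Proof. exact: continuous_max0 bcf.1. Qed.

Let cfneg : continuous fneg.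
Proof. by apply: continuous_max0 => p; apply: cvgN; exact: bcf.1. Qed.

Let bounds : exists M : R, forall p, (fpos p <= M)%R /\ (fneg p <= M)%R.
Proof.
(* [bounded_fun] yields a bound for every number strictly above [M]; [|M| + 1] is one. *)
have [M [Mr fM]] := bcf.2; exists (`|M| + 1)%R => p.
have fp : (`|f p| <= `|M| + 1)%R.
  by apply: fM => //; rewrite (le_lt_trans (ler_norm _))// ltrDl.
rewrite !ge_max !addr_ge0// !andbT (le_trans (ler_norm _) fp).
by rewrite -normrN in fp; rewrite (le_trans (ler_norm _) fp).
Qed.

Lemma cvg_thermalized :
  \int[thermalized dot mu beta]_p (f p)%:E @[beta --> +oo%R] -->
    \int[diagonal_limit]_p (f p)%:E.
Proof.
have [M fM] := bounds.
have pM p : (fpos p <= M)%R by have [] := fM p.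
have nM p : (fneg p <= M)%R by have [] := fM p.
under eq_fun do rewrite integralE EfposE EfnegE.
rewrite integralE EfposE EfnegE; apply: cvgeB.
(* The difference of the limits must avoid [+oo - +oo]; the limit for the positive part is
   finite. *)
- apply: fin_num_adde_defr; rewrite ge0_fin_numE.
    exact: integral_diagonal_limit_lty cfpos fpos_ge0 pM.
  by apply: integral_ge0 => p _; rewrite lee_fin.
- exact: cvg_thermalized_ge0 cfpos fpos_ge0 pM.
- exact: cvg_thermalized_ge0 cfneg fneg_ge0 nM.
Qed.

(** As [H] is nonnegative, the positive and negative parts of [f H] are those of [f] times [H]. *)
Lemma integral_diagonal_limit :
  \int[diagonal_limit]_p (f p)%:E =
  \int[lebesgue_rV]_xi (f (xi, xi) * H xi)%:E.
Proof.
have mp : measurable_fun setT (fun p => (fpos p)%:E).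
  by apply/measurable_EFinP; exact: continuous_measurable_prod.
have mn : measurable_fun setT (fun p => (fneg p)%:E).
  by apply/measurable_EFinP; exact: continuous_measurable_prod.
rewrite integralE EfposE EfnegE [RHS]integralE.
rewrite !ge0_integral_diagonal_limit//.
congr (_ - _); apply: eq_integral => xi _.
- by rewrite funeposE -EFin_max -EFinM maxr_pMl ?mul0r//; exact: G0.
- by rewrite funenegE -EFinN -EFin_max -EFinM -mulNr maxr_pMl ?mul0r//; exact: G0.
Qed.

End test_function.

End thermalization.

(** * Existence and identification of the weak limit *)

Theorem theorem4p5 (R : realType) (N : nat) (N_ge1 : (1 <= N)%N)
    (dot : {dot 'rV[R]_(2 * N) for @idfun R})
    (mu : {measure set ('rV[R]_(2 * N) * 'rV[R]_(2 * N)) -> \bar R})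
    (mu_radon : radon mu)
    (L : 'rV[R]_(2 * N) * 'rV[R]_(2 * N) -> R)
    (L_loc : loc_integrable L)
    (L_ge0 : {ae (lebesgue_rV \x lebesgue_rV)%E, forall p, 0 <= L p})
    (mu_density : forall A, measurable A ->
      mu A = (\int[lebesgue_rV \x lebesgue_rV]_(p in A) (L p)%:E)%E)
    (Lhat : 'rV[R]_(2 * N) -> R)
    (L_lim : {ae (lebesgue_rV \x lebesgue_rV)%E, forall p,
      L (scaled_rotation lambda p) @[lambda --> +oo] -->
        Lhat ((Num.sqrt 2)^-1 *: p.1)})
    (L_equi : exists (g : 'rV[R]_(2 * N) * 'rV[R]_(2 * N) -> R)
        (lambda0 beta0 : R),
      [/\ (lebesgue_rV \x lebesgue_rV)%E.-integrable setT (EFin \o g),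
          0 < lambda0, 0 < beta0 &
          forall lambda, lambda0 <= lambda ->
            {ae (lebesgue_rV \x lebesgue_rV)%E, forall p,
              gauss_weight_bar dot beta0 p.2 * L (scaled_rotation lambda p)
                <= g p}]) :
  exists mu_inf : {measure set ('rV[R]_(2 * N) * 'rV[R]_(2 * N)) -> \bar R},
    weak_cvg (thermalized dot mu) mu_inf /\
    forall f : 'rV[R]_(2 * N) * 'rV[R]_(2 * N) -> R, bounded_continuous f ->
      (\int[mu_inf]_p (f p)%:E = \int[lebesgue_rV]_xi (f (xi, xi) * Lhat xi)%:E)%E.
Proof.
have [g [lambda0 [beta0 [ig lambda0_gt0 beta0_gt0 Lg]]]] := L_equi.
have [L0 LL0 [mL0 _]] := L_loc.
pose s : R := (Num.sqrt 2)^-1.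
pose leb2 := (@lebesgue_rV R (2 * N) \x @lebesgue_rV R (2 * N))%E.
(* [L] has both its sign and its Borel version only up to null sets; [L'] is Borel and nonnegative
   everywhere. *)
pose L' p := Num.max (L0 p) 0.
have mL' : measurable_fun setT L' by exact: measurable_maxr.
have L'0 p : 0 <= L' p by rewrite le_max lexx orbT.
have LL' : {ae leb2, forall p, L p = L' p}.
  apply: filterS2 LL0 L_ge0 => p -> Lp; exact/esym/max_idPl.
have muE A : measurable A -> mu A = (\int[leb2]_(p in A) (L' p)%:E)%E.
  move=> mA; rewrite mu_density//; apply: ae_eq_integral_set_r => //.
    exact/measurable_EFinP.
  by apply: filterS LL' => p ->.
have L'g lambda : lambda0 <= lambda -> {ae leb2, forall p,
    gauss_weight_bar dot beta0 p.2 * L' (scaled_rotation lambda p) <= g p}.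
  move=> ll; have l0 : 0 < lambda by exact: lt_le_trans ll.
  by apply: filterS2 (Lg _ ll) (ae_scaled_rotation l0 LL') => p + <-.
have L'lim (l : nat -> R) : (forall k, 0 < l k) -> l k @[k --> \oo] --> +oo ->
    {ae leb2, forall p, L' (scaled_rotation (l k) p) @[k --> \oo] -->
      Lhat (s *: p.1)}.
  move=> l0 ly.
  (* For each [k], [L] and [L'] agree along [S_(l k)] off a null set; the countable union of these
     sets is null. *)
  apply: filterS2 L_lim (ae_foralln (fun k => ae_scaled_rotation (l0 k) LL')).
  move=> p Lp LpE; have := cvg_comp l (fun x => L (scaled_rotation x p)) ly Lp.
  by apply: cvg_trans; apply: near_eq_cvg; apply: nearW => k /=.
(* The limit depends on the first variable only, so freezing the second gives a Borel [G]; the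
   sequence [k + 1] keeps [lambda] positive. *)
have [G [mG G0 GE]] : exists G : 'rV[R]_(2 * N) -> R,
    [/\ measurable_fun setT G, forall xi, 0 <= G xi &
      {ae lebesgue_rV, forall xi, Lhat (s *: xi) = G xi}].
  apply: (@ae_fst_limit _ _ _ _ R lebesgue_rV lebesgue_rV
    (fun k p => L' (scaled_rotation k.+1%:R p)) (fun xi => Lhat (s *: xi))).
  - by move=> k; apply: measurableT_comp => //; exact: measurable_scaled_rotation.
  - by [].
  - exact: lebesgue_rV_setT_gt0.
  - by apply: L'lim => //; apply: cvg_comp (cvg_addnl 1) cvgr_idn.
have L'G (l : nat -> R) : (forall k, 0 < l k) -> l k @[k --> \oo] --> +oo ->
    {ae leb2, forall p, L' (scaled_rotation (l k) p) @[k --> \oo] --> G p.1}.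
  move=> l0 ly; apply: filterS2 (L'lim l l0 ly) (ae_product_fst lebesgue_rV GE).
  by move=> p + <-.
(* Dilation by [sqrt 2] undoes the factor [s] and preserves null sets. *)
have HE : {ae lebesgue_rV, forall xi, Lhat xi = G (Num.sqrt 2 *: xi)}.
  have s0 : Num.sqrt 2 != 0 :> R by rewrite gt_eqF// sqrtr_gt0.
  apply: filterS (ae_lebesgue_rV_scale s0 GE) => xi <-.
  by rewrite scalerA mulVf// scale1r.
exists (diagonal_limit mG G0); split; last first.
  move=> f bcf; rewrite integral_diagonal_limit//.
  (* [Lhat] is an arbitrary function; its integral is compared with that of its Borel version. *)
  apply/esym; apply: ae_eq_integral_r; last by apply: filterS HE => xi ->.
  apply/measurable_EFinP; apply: measurable_funM.
    apply: (measurableT_comp (continuous_measurable_prod bcf.1)).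
    exact: measurable_fun_pair.
  have := @measurable_affine R (2 * N) (Num.sqrt 2) 0.
  under eq_fun do rewrite addr0.
  exact: measurableT_comp.
split.
- near=> beta.
  apply: (finite_radon_thermalized mL' L'0 muE beta0_gt0 ig lambda0_gt0 L'g).
  by near: beta; apply: nbhs_pinfty_ge; exact: num_real.
- exact: (finite_radon_diagonal_limit mL' L'0 muE beta0_gt0 ig lambda0_gt0 L'g
    mG G0 L'G).
- move=> f bcf.
  exact: (cvg_thermalized mL' L'0 muE beta0_gt0 ig lambda0_gt0 L'g L'G bcf).
Unshelve. all: by end_near. Qed.
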